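(* Consider the stochastic (Gaussian white) noise setting with noise level $\delta>0$, and let $n_*=n_*(\tau)$ be the fast balancing parameter built from $b_1$. Assume that $x$ satisfies the Spectral Assumption, let $0<w_1<1$ and $w_2>1$ be constants such that $\|x-x_{n+1}\|\le w_1\|x-x_n\|$ and $\rho(n)\le\rho(n+1)\le w_2\rho(n)$ for all levels $n$, and assume that the Decorrelation Assumption holds with constant $C_3=C_3(w_1,w_2)$ and parameter $\tau$. Then there exist constants $c_5,c_6$ depending only on $w_1$ and $w_2$ such that $$\mathbb E\,\|x_{n_*}^\delta-x\|^2\le c_5\left(1+c_6\exp(\tau^2/2)+c_5\,\frac{1}{1-C_3\exp(-\tau^2/8)\,w_2}\right)\left(\|x_{n_{opt}}-x\|^2+\rho(n_{opt})^2\right).$$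
   Context: **Operator.** $\mathcal X,\mathcal Y$ are separable real infinite-dimensional Hilbert spaces, $A:\mathcal X\to\mathcal Y$ is a compact linear operator with trivial null-space, with singular value decomposition $Ax=\sum_{k=1}^\infty\sigma_k\langle x,u_k\rangle v_k$, where $(u_k)$, $(v_k)$ are orthonormal bases of $\mathcal X$, $\mathcal Y$ and $(\sigma_k)$ is the decreasing sequence of singular values. **Data and Tikhonov regularization.** $x\in\mathcal X$ is the exact (deterministic) solution, $y=Ax$, and $y^\delta=Ax+\xi$ with noise $\xi$. Fix $q_0>0$ and $0<q<1$. For levels $n\in\mathbb N=\{1,2,\dots\}$ put $A_n^{-1}:=(A^*A+q_0q^n I)^{-1}A^*$ (a notation, not an actual inverse), $x_n:=A_n^{-1}y$ and $x_n^\delta:=A_n^{-1}y^\delta=x_n+A_n^{-1}\xi$. **Stochastic noise.** $\xi$ is Gaussian white noise: the coefficients $\xi_k=\langle\xi,v_k\rangle$ are independent $\mathcal N(0,\delta^2)$ variables, and $A_n^{-1}\xi=\sum_k\frac{\sigma_k}{\sigma_k^2+q_0q^n}\,\xi_k u_k$. The noise behavior is $\rho(n)\ge0$ with $\rho(n)^2:=\mathbb E\|A_n^{-1}\xi\|^2$, implicitly finite. **Spectral Assumption on $x$.** Either $\|(A^*A)^{-1}x\|<\infty$ (i.e. $x$ lies in the range of $A^*A$), or there exist constants $\gamma>0$, $0<\nu<1$, $C_{\gamma,\nu}>0$, $D_{\gamma,\nu}>0$ such that for all $0\le t\le\gamma$ $$D_{\gamma,\nu}^2t^{2\nu}\ \ge\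 \sum_{\{k:\ \sigma_k^2\le t\}}\langle x,u_k\rangle^2\ \ge\ C_{\gamma,\nu}^2t^{2\nu}.$$ (Under this assumption a constant $w_1$ as in the claim is known to exist.) **Optimal parameter.** $n_{opt}$ is the level such that $\|x_{n_{opt}}-x\|>\rho(n_{opt})$ and $\|x_{n_{opt}+1}-x\|\le\rho(n_{opt}+1)$; its existence is a standing assumption. **Balancing functional and fast balancing ($k=1$).** $b_1(n):=\tfrac14\,\|x_n^\delta-x_{n+1}^\delta\|\,\rho(n+1)^{-1}$; for $\tau\ge0$, $n_*(\tau)$ is the smallest $n$ with $b_1(n)<\tau$. **Constant $c_3$.** $c_3>0$ denotes a constant depending only on $w_1,w_2$ (not on $\delta$ or $\tau$) such that $\mathbb P\{b_1(n)\ge\tau\}\le c_3\exp(-\tau^2/4)$ for all $n>n_{opt}$. **Decorrelation Assumption.** There exists a constant $C_3=C_3(w_1,w_2)>c_3$ such that for $n>n_{opt}$ $$\mathbb P\{n_*=n\}\le\left(C_3\exp(-\tau^2/4)\right)^{n-n_{opt}},$$ and $\tau$ is big enough that $C_3\exp(-\tau^2/4)\,w_2<1$.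
   Formalization: The condition C_3 exp(-τ²/8) w_2 < 1 is added, so that the denominator in the bound is positive; under the stated condition with exp(-τ²/4) alone it can be zero or negative, making the bound undefined or negative. *)

(* Defs.v *)
From HB Require Import structures.
From mathcomp Require Import all_boot all_order all_algebra finmap.
From mathcomp Require Import all_classical all_reals all_analysis.

Set Implicit Arguments.
Unset Strict Implicit.
Unset Printing Implicit Defensive.

Import Order.TTheory GRing.Theory Num.Theory.
Import numFieldNormedType.Exports.

Local Open Scope classical_set_scope.
Local Open Scope ring_scope.

(* Sequences of singular values and basis vectors are indexed from 0, whereas
   regularization levels [n] range over the positive integers. *)

Section hilbert.
Context {R : realType}.

(* A real Hilbert space is a [completeNormedModType R] whose norm comes from
   an inner product. *)
Definition induces_norm (X : normedModType R) (ip : {dot X for idfun}) :=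
  forall x : X, `|x| ^+ 2 = ip x x.

Definition separable (X : topologicalType) :=
  exists S : set X, countable S /\ dense S.

Definition infinite_dimensional (X : lmodType R) :=
  ~ exists s : seq X, forall x : X, exists c : nat -> R,
      x = \sum_(i < size s) c i *: s`_i.

Definition orthonormal_basis (X : normedModType R) (ip : {dot X for idfun})
    (e : nat -> X) :=
  (forall i j, ip (e i) (e j) = (i == j)%:R) /\
  (forall x, series (fun k => ip x (e k) *: e k) n @[n --> \oo] --> x).

Definition compact_operator (X Y : normedModType R) (A : X -> Y) :=
  compact (closure (A @` [set x | `|x| <= 1])).

Definition singular_value_decomposition (X Y : normedModType R)
    (ipX : {dot X for idfun}) (ipY : {dot Y for idfun}) (A : X -> Y)
    (sigma : nat -> R) (u : nat -> X) (v : nat -> Y) :=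
  [/\ orthonormal_basis ipX u, orthonormal_basis ipY v,
      (forall k, 0 < sigma k),
      nonincreasing_seq sigma &
      forall x, series (fun k => (sigma k * ipX x (u k)) *: v k) n
                  @[n --> \oo] --> A x].

(* [xget] picks the unique vector with the given property; for a bounded
   operator [A] it exists by the Riesz representation theorem. *)
Definition adjoint (X Y : normedModType R)
    (ipX : {dot X for idfun}) (ipY : {dot Y for idfun}) (A : X -> Y)
    (y : Y) : X :=
  xget 0 [set z | forall x, ipX x z = ipY (A x) y].

(* (A^* A + alpha I)^-1 A^* y, i.e. the solution z of the regularized normal
   equation, unique as soon as alpha > 0. *)
Definition tikhonov (X Y : normedModType R)
    (ipX : {dot X for idfun}) (ipY : {dot Y for idfun}) (A : X -> Y)
    (alpha : R) (y : Y) : X :=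
  xget 0 [set z | adjoint ipX ipY A (A z) + alpha *: z = adjoint ipX ipY A y].

Definition spectral_assumption (X Y : normedModType R)
    (ipX : {dot X for idfun}) (ipY : {dot Y for idfun}) (A : X -> Y)
    (sigma : nat -> R) (u : nat -> X) (x : X) :=
  (exists z, adjoint ipX ipY A (A z) = x) \/
  (exists gamma nu C D : R,
    [/\ 0 < gamma, 0 < nu < 1, 0 < C, 0 < D &
      forall t : R, 0 <= t <= gamma ->
        let tail :=
          (\sum_(0 <= k <oo | (sigma k ^+ 2 <= t)%R) ((ipX x (u k)) ^+ 2)%:E)%E in
        ((C ^+ 2 * t `^ (2 * nu))%:E <= tail)%E /\
        (tail <= (D ^+ 2 * t `^ (2 * nu))%:E)%E]).

End hilbert.

Section noise.
Context {R : realType} {d : measure_display} {Omega : measurableType d}.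
Variable P : probability Omega R.

Definition independent_seq (xi : nat -> {RV P >-> R}) :=
  forall (F : {fset nat}) (B : nat -> set R), (forall k, measurable (B k)) ->
    P (\bigcap_(k in [set` F]) (xi k @^-1` B k)) =
    (\prod_(k <- F) P (xi k @^-1` B k))%E.

(* The coefficients of the noise with respect to the basis (v_k). White noise
   is not an element of the data space, so there is no random vector xi. *)
Definition white_noise (delta : R) (xi : nat -> {RV P >-> R}) :=
  independent_seq xi /\
  forall k (B : set R), measurable B ->
    distribution P (xi k) B = normal_prob 0 delta B.

Definition noise_series (X : normedModType R) (sigma : nat -> R)
    (u : nat -> X) (xi : nat -> {RV P >-> R}) (alpha : R) (w : Omega)
    : nat -> X :=
  series (fun k => (sigma k / (sigma k ^+ 2 + alpha) * xi k w) *: u k).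

(* Only meaningful for those [w] for which the series converges. *)
Definition propagated_noise (X : normedModType R) (sigma : nat -> R)
    (u : nat -> X) (xi : nat -> {RV P >-> R}) (alpha : R) (w : Omega) : X :=
  limn (noise_series sigma u xi alpha w).

End noise.

Definition balancing_functional {R : realType} (X : normedModType R)
    (Omega : Type) (rho : nat -> R) (xdelta : nat -> Omega -> X)
    (n : nat) (w : Omega) : R :=
  4^-1 * `|xdelta n w - xdelta n.+1 w| * (rho n.+1)^-1.

(* The smallest level n >= 1 with b n < tau. The value 0, which is not a level,
   means that there is no such n. *)
Definition balancing_level {R : realType} (b : nat -> R) (tau : R) : nat :=
  if pselect (exists n, (0 < n)%N && (b n < tau)) is left h
  then ex_minn h else 0%N.

Definition is_optimal_level {R : realType} (X : normedModType R)
    (x : X) (xn : nat -> X) (rho : nat -> R) (nopt : nat) :=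
  [/\ (0 < nopt)%N, rho nopt < `|xn nopt - x| &
      `|xn nopt.+1 - x| <= rho nopt.+1].

(* Main.v *)
Require Import Defs.
From HB Require Import structures.
From mathcomp Require Import all_boot all_order all_algebra finmap.
From mathcomp Require Import all_classical all_reals all_analysis.
From mathcomp Require Import measurable_realfun ring lra.

Set Implicit Arguments.
Unset Strict Implicit.
Unset Printing Implicit Defensive.

Import Order.TTheory GRing.Theory Num.Theory.
Import numFieldNormedType.Exports.

Local Open Scope classical_set_scope.
Local Open Scope ring_scope.

(** Write e_n = x_n - x for the bias at level n, eta_n for the propagated noise,
    N for the optimal level and n* for the balancing level. The error at n* is
    estimated according to the position of n* relative to N.

    Levels n <= N. With respect to the basis (u_k), the coordinates of eta_n are
    xi_k sigma_k / (sigma_k^2 + alpha_n), and alpha_n decreases; so the norm of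
    eta_n increases with n for every realization of the noise ([norm_noise_le]).
    If a level n < N is accepted, then the reconstructions at n and n + 1 differ
    by at most 4 tau rho(N), hence e_n and e_(n+1) by at most
    4 tau rho(N) + 2 |eta_N|, and the contraction of the bias bounds |e_n| by
    this quantity divided by 1 - w1 ([early_error]). The bound is the same for
    all these levels, so no sum over them is needed, and its second moment is of
    order (1 + tau^2) (|e_N|^2 + rho(N)^2).

    Levels n = N + m with m > 0. The reconstruction is compared with the one at
    N + 1 by adding up the increments in between, which are
    4 rho(j + 1) b1(j) with rho growing at most like w2^j ([late_error]). On the
    event n* = N + m, whose probability is at most p^m with
    p = C3 exp(- tau^2 / 4), the tail bound for b1 shows that b1(j)^2 has integral
    at most of order p^m m (1 + tau^2) ([restricted_second_moment]). The sum over
    m of w2^(2m) p^m m converges ([tail_levels_second_moment]): the square of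
    C3 exp(- tau^2 / 8) w2 < 1 is C3 w2^2 p, so w2^2 p < 1 / C3, and
    1 / C3 < 1 because c3 < C3 and because the tail bound at t = 0 forces
    c3 >= 1.

    No accepted level. This has probability zero ([all_levels_rejected_null]).
    For n large, b1(n) is close to a quarter of |eta_(n+1) - eta_n| / rho(n + 1),
    whose square is a weighted sum of the xi_k^2 in which each single weight
    tends to zero as n grows. The event that its lower limit is at least
    16 tau^2 is therefore a tail event of the sequence (xi_k), and has probability
    0 or 1 by Kolmogorov's law ([tail_event_zero_one]). Probability 1 would contradict the
    bound on the probability that b1(n) >= t, for t slightly below tau.

    Altogether the expectation is at most
    (a + b tau^2) (|e_N|^2 + rho(N)^2), and tau^2 <= 2 exp(tau^2 / 2). *)

(** * Expansions along an orthonormal basis *)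

Section orthonormal_expansion.
Context {R : realType} {X : completeNormedModType R}.
Variables (ip : {dot X for idfun}) (e : nat -> X).
Hypothesis ipE : induces_norm ip.
Hypothesis eB : orthonormal_basis ip e.

Lemma ipC x y : ip x y = ip y x.
Proof. by rewrite hermC /= expr0 mul1r. Qed.

Lemma ipDl x y z : ip (x + y) z = ip x z + ip y z.
Proof. exact: linearDl. Qed.

Lemma ipBl x y z : ip (x - y) z = ip x z - ip y z.
Proof. exact: linearBl. Qed.

Lemma ipZl (a : R) x y : ip (a *: x) y = a * ip x y.
Proof. by rewrite ipC linearZr /= ipC. Qed.

Lemma ip_suml I (r : seq I) (Q : pred I) (F : I -> X) y :
  ip (\sum_(i <- r | Q i) F i) y = \sum_(i <- r | Q i) ip (F i) y.
Proof. by rewrite ipC linear_sumr; apply: eq_bigr => i _; rewrite ipC. Qed.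

Lemma ip_sum_basis (c : nat -> R) m n j :
  ip (\sum_(m <= k < n) c k *: e k) (e j) =
  if (m <= j < n)%N then c j else 0.
Proof.
rewrite ip_suml.
under eq_bigr => k _ do rewrite ipZl eB.1 mulr_natr mulrb.
case: ifPn => [jmn|jmn].
  rewrite (bigD1_seq j) ?mem_index_iota ?iota_uniq //= eqxx.
  by rewrite big1 ?addr0 // => k /negbTE ->.
rewrite big_seq big1 // => k; rewrite mem_index_iota.
by case: eqP => // -> kmn; rewrite kmn in jmn.
Qed.

Lemma normD_sqr_ip x y : `|x + y| ^+ 2 = `|x| ^+ 2 + `|y| ^+ 2 + 2 * ip x y.
Proof.
rewrite !ipE ipDl (ipC x) (ipC y) !ipDl (ipC y x); ring.
Qed.

Lemma norm_sum_basis (c : nat -> R) m n :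
  `|\sum_(m <= k < n) c k *: e k| ^+ 2 = \sum_(m <= k < n) c k ^+ 2.
Proof.
elim: n => [|n IH]; first by rewrite !big_geq // normr0 expr0n.
have [mn|nm] := leqP m n; last by rewrite !big_geq // normr0 expr0n.
rewrite !big_nat_recr //= normD_sqr_ip IH (ipC _ (_ *: _)) ipZl ipC.
rewrite ip_sum_basis ltnn andbF !mulr0 addr0; congr (_ + _).
by rewrite ipE ipZl ipC ipZl eB.1 eqxx mulr1 expr2.
Qed.

Lemma parseval x :
  series (fun k => ip x (e k) ^+ 2) n @[n --> \oo] --> `|x| ^+ 2.
Proof.
have -> : series (fun k => ip x (e k) ^+ 2) =
    (fun n => `|series (fun k => ip x (e k) *: e k) n| ^+ 2).
  by apply/funext => n; rewrite /series /= norm_sum_basis.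
under eq_fun do rewrite expr2.
by rewrite expr2; apply: cvgM; apply: cvg_norm; exact: eB.2.
Qed.

Lemma parseval_nneseries x :
  ((`|x| ^+ 2)%:E = \sum_(0 <= k <oo) (ip x (e k) ^+ 2)%:E)%E.
Proof.
apply/esym/cvg_lim => //.
have -> : (fun n => \sum_(0 <= k < n) (ip x (e k) ^+ 2)%:E)%E =
    EFin \o series (fun k => ip x (e k) ^+ 2).
  by apply/funext => n /=; rewrite sumEFin.
by apply/fine_cvgP; split; [exact: nearW|exact: parseval].
Qed.

Lemma ip_basis_le x j : `|ip x (e j)| <= `|x|.
Proof.
rewrite -(@ler_sqr _ `|ip _ _|) ?nnegrE // real_normK ?num_real //.
rewrite -lee_fin parseval_nneseries.
rewrite (@nneseriesD1 _ _ j) //; last by move=> k _; rewrite lee_fin sqr_ge0.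
rewrite leeDl //; apply: nneseries_ge0 => k _ _; rewrite lee_fin sqr_ge0 //.
Qed.

Lemma coord_of_expansion (c : nat -> R) y j :
  series (fun k => c k *: e k) n @[n --> \oo] --> y -> ip y (e j) = c j.
Proof.
move=> cy; apply/eqP; rewrite -subr_eq0 -normr_le0; apply/ler_addgt0Pl => eps eps0.
rewrite addr0.
have [n [jn ny]] : exists n, (j < n)%N /\
    `|y - series (fun k => c k *: e k) n| <= eps.
  have /cvgrPdist_le /(_ _ eps0) [N _ HN] := cy.
  by exists (maxn N j.+1); split; [rewrite leq_maxr|apply: HN; rewrite /= leq_maxl].
apply: le_trans ny; apply: le_trans (ip_basis_le _ j).
by rewrite ipBl /series /= ip_sum_basis jn.
Qed.

Lemma cvgn_expansion (c : nat -> R) :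
  cvgn (series (fun k => c k *: e k)) <-> cvgn (series (fun k => c k ^+ 2)).
Proof.
split=> /cauchy_cvgP/cauchy_seriesP cc;
  apply/cauchy_cvgP/cauchy_seriesP => eps eps0.
  have := cc (Num.sqrt eps); rewrite sqrtr_gt0 => /(_ eps0).
  apply: filterS => -[m n] /=.
  rewrite -norm_sum_basis normrX normr_id.
  by rewrite -[in X in _ -> X](sqr_sqrtr (ltW eps0)) ltr_pXn2r // nnegrE ?sqrtr_ge0.
have := cc (eps ^+ 2); rewrite exprn_gt0 // => /(_ isT).
apply: filterS => -[m n] /=.
by rewrite -norm_sum_basis normrX normr_id ltr_pXn2r // nnegrE ?(ltW eps0).
Qed.

End orthonormal_expansion.

(** Vector-valued random variables are handled through their coordinates: that
    all coordinates are measurable is stable under the vector operations, and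
    makes the norm measurable by Parseval's identity. *)
Definition coord_measurable {R : realType} {X : normedModType R}
    (ip : {dot X for idfun}) (e : nat -> X) {d} {Omega : measurableType d}
    (f : Omega -> X) :=
  forall k, measurable_fun setT (fun w => ip (f w) (e k)).

Section coord_measurable.
Context {R : realType} {X : completeNormedModType R}.
Variables (ip : {dot X for idfun}) (e : nat -> X).
Hypothesis ipE : induces_norm ip.
Hypothesis eB : orthonormal_basis ip e.
Context {d : measure_display} {Omega : measurableType d}.

Lemma coord_measurable_cst (x : X) :
  coord_measurable ip e (fun _ : Omega => x).
Proof. by move=> k; exact: measurable_cst. Qed.

Lemma coord_measurableD (f g : Omega -> X) :
  coord_measurable ip e f -> coord_measurable ip e g ->
  coord_measurable ip e (fun w => f w + g w).
Proof.
move=> mf mg k; under eq_fun do rewrite ipDl.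
exact: measurable_funD.
Qed.

Lemma coord_measurableB (f g : Omega -> X) :
  coord_measurable ip e f -> coord_measurable ip e g ->
  coord_measurable ip e (fun w => f w - g w).
Proof.
move=> mf mg k; under eq_fun do rewrite ipBl.
exact: measurable_funB.
Qed.

Lemma measurable_norm_coord (f : Omega -> X) :
  coord_measurable ip e f -> measurable_fun setT (fun w => `|f w|).
Proof.
move=> mf.
have -> : (fun w => `|f w|) = Num.sqrt \o (fun w => `|f w| ^+ 2).
  by apply/funext => w /=; rewrite sqrtr_sqr normr_id.
apply: measurableT_comp.
  by apply: continuous_measurable_fun; exact: sqrt_continuous.
apply: (@measurable_fun_cvg _ _ _ _ 
   (fun n w => series (fun k => ip (f w) (e k) ^+ 2) n)) => [n|w _].
  by apply: measurable_sum => k; exact: measurable_funX.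
exact: parseval.
Qed.

Variables (c : nat -> Omega -> R).
Hypothesis mc : forall k, measurable_fun setT (c k).

Lemma measurable_cvgn_expansion :
  measurable [set w | cvgn (series (fun k => c k w *: e k))].
Proof.
pose s w := (\sum_(0 <= k <oo) (c k w ^+ 2)%:E)%E.
have -> : [set w | cvgn (series (fun k => c k w *: e k))] =
    setT `&` [set w | (s w < +oo)%E].
  rewrite setTI; apply/funext => w /=; apply/propext.
  rewrite (cvgn_expansion ipE eB); split => [cs|].
    rewrite /s (_ : (fun n => _) = EFin \o series (fun k => c k w ^+ 2)).
      by rewrite EFin_lim // ltry.
    by apply/funext => n /=; rewrite sumEFin.
  by apply: nnseries_is_cvg => k; exact: sqr_ge0.
apply: emeasurable_fun_infty_o => //.
apply: ge0_emeasurable_sum => [k w _ _|k _]; first by rewrite lee_fin sqr_ge0.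
by apply/measurable_EFinP; exact: measurable_funX.
Qed.

(** On the measurable set where the series converges its coordinates are the
    given ones; elsewhere the limit takes a fixed default value. *)
Lemma coord_measurable_expansion :
  coord_measurable ip e (fun w => limn (series (fun k => c k w *: e k))).
Proof.
move=> k.
have -> : (fun w => ip (limn (series (fun k => c k w *: e k))) (e k)) =
  (fun w => if w \in [set w | cvgn (series (fun k => c k w *: e k))]
            then c k w else ip point (e k)).
  apply/funext => w; case: ifPn => [|]; rewrite ?inE ?notin_setE /= => cw.
    exact: (coord_of_expansion ipE eB (c := c^~ w)).
  by rewrite dvgP.
apply: measurable_fun_ifT => //.
apply: (measurable_fun_bool true) => //=.
rewrite setTI.
rewrite (_ : _ @^-1` _ = [set w | cvgn (series (fun k => c k w *: e k))]).
  exact: measurable_cvgn_expansion.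
by apply/seteqP; split => w /=; [move/set_mem|move/mem_set].
Qed.

End coord_measurable.

(** * The zero-one law *)

Section zero_one.
Context {R : realType} {d : measure_display} {Omega : measurableType d}.
Variable P : probability Omega R.

(** By Dynkin's lemma, independence of a family of events that is closed under
    intersection extends to the sigma-algebra it generates. *)
Lemma independent_generated (G : set (set Omega)) (E : set Omega) :
  measurable E -> setI_closed G -> (forall B, G B -> measurable B) ->
  (forall B, G B -> P (E `&` B) = (P E * P B)%E) ->
  forall B, <<s G >> B -> P (E `&` B) = (P E * P B)%E.
Proof.
move=> mE GI mG EG B.
rewrite -(setI_closed_g_dynkin_g_sigma_algebra GI).
pose H := [set B : set Omega | measurable B /\ P (E `&` B) = (P E * P B)%E].
suff dH : dynkin H by move=> /(_ H) []; first by split => // C GC; split; auto.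
split.
- by split; rewrite ?setIT ?probability_setT ?mule1 //; exact: measurableT.
- move=> C [mC EC]; split; first exact: measurableC.
  rewrite -setDE measureD //; last exact: le_lt_trans (probability_le1 _ _) (ltry 1).
  rewrite probability_setC //.
  by rewrite muleBr ?mule1 ?fin_num_measure // -EC.
- move=> F tF HF; split; first by apply: bigcupT_measurable => k; case: (HF k).
  rewrite setI_bigcupr measure_bigcup //; last first.
  + exact: trivIset_setIl.
  + by move=> k _; apply: measurableI => //; case: (HF k).
  rewrite measure_bigcup //; last by move=> k _; case: (HF k).
  have PE : P E = (fine (P E))%:E by rewrite fineK // fin_num_measure.
  rewrite PE -nneseriesZl // -PE.
  by apply: eq_eseriesr => k _; case: (HF k).
Qed.

Variable xi : nat -> {RV P >-> R}.
Hypothesis xi_indep : independent_seq xi.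

Definition cylinders (K : nat) : set (set Omega) :=
  [set C | exists (F : {fset nat}) (B : nat -> set R),
     [/\ forall k, measurable (B k), (forall k, k \in F -> (K <= k)%N) &
         C = \bigcap_(k in [set` F]) (xi k @^-1` B k)]].

Lemma measurable_cylinder K C : cylinders K C -> measurable C.
Proof.
move=> [F [B [mB _ ->]]]; apply: fin_bigcap_measurable => // k _.
exact: measurable_funPTI.
Qed.

Lemma cylinders_setI K : setI_closed (cylinders K).
Proof.
move=> _ _ [F [B [mB FK ->]]] [F' [B' [mB' FK' ->]]].
exists (F `|` F')%fset, (fun k => (if k \in F then B k else setT) `&`
                             (if k \in F' then B' k else setT)).
split.
- by move=> k; apply: measurableI; case: ifP.
- by move=> k; rewrite in_fsetU => /orP[/FK|/FK'].
apply/seteqP; split => w /=.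
  move=> [wF wF'] k /= _; split; case: ifP => // kF; [exact: wF|exact: wF'].
move=> wFF'; split => k /= kF; have := wFF' k; rewrite /= in_fsetU kF ?orbT /=;
  by move=> /(_ isT) [].
Qed.

(** The product rule for single coordinates, applied to the union of two
    disjoint sets of indices. *)
Lemma cylinder_independent K (F : {fset nat}) (B : nat -> set R) C :
  (forall k, measurable (B k)) -> (forall k, k \in F -> (k < K)%N) ->
  cylinders K C ->
  let C0 := \bigcap_(k in [set` F]) (xi k @^-1` B k) in
  P (C0 `&` C) = (P C0 * P C)%E.
Proof.
move=> mB FK [F' [B' [mB' FK' ->]]] /=.
pose B2 k := if k \in F then B k else B' k.
have dF k : k \in F' -> k \notin F.
  by move=> /FK'; rewrite leqNgt; apply: contra => /FK.
have FB : \bigcap_(k in [set` F]) (xi k @^-1` B k) =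
    \bigcap_(k in [set` F]) (xi k @^-1` B2 k).
  by apply: eq_bigcapr => k /= kF; rewrite /B2 kF.
have FB' : \bigcap_(k in [set` F']) (xi k @^-1` B' k) =
    \bigcap_(k in [set` F']) (xi k @^-1` B2 k).
  by apply: eq_bigcapr => k /= kF; rewrite /B2 (negbTE (dF _ kF)).
have mB2 k : measurable (B2 k) by rewrite /B2; case: ifP.
rewrite FB FB' -bigcap_setU -set_fsetU !xi_indep //.
rewrite -big_cat; apply: perm_big; apply: uniq_perm.
- exact: fset_uniq.
- rewrite cat_uniq !fset_uniq andbT /=.
  by apply/hasPn => k /dF.
- by move=> k; rewrite mem_cat in_fsetU.
Qed.

Lemma cylinder_of_initial C : cylinders 0 C ->
  exists K (F : {fset nat}) (B : nat -> set R),
    [/\ forall k, measurable (B k), (forall k, k \in F -> (k < K)%N) &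
         C = \bigcap_(k in [set` F]) (xi k @^-1` B k)].
Proof.
move=> [F [B [mB _ ->]]]; exists (\max_(k <- F) k).+1, F, B; split => // k kF.
by rewrite ltnS (big_rem k) //= leq_maxl.
Qed.

(** Kolmogorov's zero-one law: a tail event is independent of every cylinder,
    hence of every event generated by the cylinders, hence of itself. *)
Lemma tail_event_zero_one (T : set Omega) :
  (forall K, <<s cylinders K >> T) -> P T = 0%E \/ P T = 1%E.
Proof.
move=> tT.
have mT : measurable T.
  move: (tT 0%N); apply: smallest_sub; first exact: sigma_algebra_measurable.
  by move=> C; exact: measurable_cylinder.
have TC C : cylinders 0 C -> P (T `&` C) = (P T * P C)%E.
  move=> C0; have [K [F [B [mB FK CE]]]] := cylinder_of_initial C0.
  rewrite setIC muleC; apply: (independent_generated _ (@cylinders_setI K)) => //.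
  - exact: measurable_cylinder C0.
  - exact: measurable_cylinder.
  - by move=> C' C'K; rewrite CE; exact: (cylinder_independent mB FK C'K).
have := independent_generated mT (@cylinders_setI 0) (@measurable_cylinder 0)
  TC (tT 0%N).
rewrite setIid.
have : P T \is a fin_num by exact: fin_num_measure.
case: (P T) => // r _; rewrite -EFinM => -[/eqP].
rewrite -subr_eq0 -{1}(mulr1 r) -mulrBr mulf_eq0 subr_eq0.
by move=> /orP[/eqP ->|/eqP <-]; [left|right].
Qed.

End zero_one.

Section weighted_squares.
Context {R : realType} {d : measure_display} {Omega : measurableType d}.
Variable P : probability Omega R.
Variable xi : nat -> {RV P >-> R}.
Hypothesis xi_indep : independent_seq xi.

Lemma measurable_coordinate_cylinders K k : (K <= k)%N ->
  measurable_fun [set: g_sigma_algebraType (cylinders xi K)]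
    (xi k : g_sigma_algebraType (cylinders xi K) -> R).
Proof.
move=> Kk _ B mB; rewrite setTI; apply: sub_sigma_algebra.
exists [fset k]%fset, (fun=> B); split => //.
  by move=> j; rewrite in_fset1 => /eqP ->.
by apply/seteqP; split => w /= wB; [move=> j /=; rewrite in_fset1 => /eqP ->|
  apply: (wB k); rewrite /= in_fset1].
Qed.

Variable a : nat -> nat -> R.
Hypothesis a_ge0 : forall n k, 0 <= a n k.
Hypothesis a_cvg0 : forall k, a n k @[n --> \oo] --> 0.

Let D K n w := (\sum_(0 <= k <oo) (a n (k + K) * xi (k + K) w ^+ 2)%:E)%E.

Let T c K := [set w | forall i, exists N, forall n, (N <= n)%N ->
  ((c - i.+1%:R^-1)%:E <= D K n w)%E].

Let tail_sigma_algebra c K : <<s cylinders xi K >> (T c K).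
Proof.
have -> : T c K = \bigcap_i \bigcup_N \bigcap_(n in [set n | (N <= n)%N])
    (setT `&` [set w | ((c - i.+1%:R^-1)%:E <= D K n w)%E]).
  apply/seteqP; split => w.
    by move=> wT i _; have [N HN] := wT i; exists N => // n /= /HN.
  by move=> wT i; have [N _ HN] := wT i I; exists N => n /HN [].
rewrite -[<<s _ >>]/(@measurable _ (g_sigma_algebraType (cylinders xi K))).
apply: bigcapT_measurable => i; apply: bigcupT_measurable => N.
apply: bigcap_measurableType => n _.
apply: emeasurable_fun_c_infty => //.
apply: ge0_emeasurable_sum => [k w _ _|k _].
  by rewrite lee_fin mulr_ge0 ?sqr_ge0.
apply/measurable_EFinP; apply: measurable_funM => //.
apply: measurable_funX; apply: measurable_coordinate_cylinders.
exact: leq_addl.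
Qed.

Let tail_eq c K : T c 0 = T c K.
Proof.
have DE n w : (D 0 n w =
    (\sum_(0 <= k < K) a n k * xi k w ^+ 2)%:E + D K n w)%E.
  rewrite /D -sumEFin.
  under eq_eseriesr do rewrite addn0.
  rewrite (@nneseries_split _ _ 0 K) ?add0n //; last first.
    by move=> k _; rewrite lee_fin mulr_ge0 ?sqr_ge0.
  congr (_ + _)%E.
  rewrite (@nneseries_addn _ (fun k => (a n k * xi k w ^+ 2)%:E) K) // => k.
  by rewrite lee_fin mulr_ge0 ?sqr_ge0.
apply/seteqP; split => w wT i.
  (* Half of the tolerance 1 / (i + 1) is left for the first K coordinates. *)
  have [N HN] := wT (i.+1.*2).-1.
  have : (\sum_(0 <= k < K) a n k * xi k w ^+ 2) @[n --> \oo] --> 0.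
    rewrite [X in _ --> X](_ : 0 = \sum_(0 <= k < K) 0 * xi k w ^+ 2); last first.
      by rewrite big1 // => k _; rewrite mul0r.
    apply: cvg_big => [|k _]; first exact: add_continuous.
    by apply: cvgM => //; exact: cvg_cst.
  have i0 : 0 < (i.+1.*2)%:R^-1 :> R by rewrite invr_gt0 ltr0n.
  move=> /cvgr0Pnorm_le /(_ _ i0) [M _ HM].
  exists (maxn N M) => n; rewrite geq_max => /andP[/HN + /HM].
  rewrite DE prednK // => h1 h2.
  have := le_trans (ler_norm _) h2.
  rewrite -lee_fin => {}h2.
  have := le_trans h1 (leeD2r _ h2).
  rewrite -leeBlDl // -EFinB; apply: le_trans; rewrite lee_fin.
  rewrite -mul2n natrM invfM.
  by move: (i.+1%:R^-1) => s; lra.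
have [N HN] := wT i; exists N => n /HN /le_trans; apply.
rewrite DE leeDr // lee_fin sumr_ge0 // => k _.
by rewrite mulr_ge0 ?sqr_ge0.
Qed.

(** Since each weight tends to zero, finitely many coordinates do not affect
    the lower limit of the weighted sums, which makes this a tail event. *)
Lemma liminf_weighted_squares_zero_one (c : R) :
  let E := [set w | forall i, exists N, forall n, (N <= n)%N ->
    ((c - i.+1%:R^-1)%:E <= \sum_(0 <= k <oo) (a n k * xi k w ^+ 2)%:E)%E] in
  measurable E /\ (P E = 0%E \/ P E = 1%E).
Proof.
move=> E.
have ET : E = T c 0.
  have D0 n w : D 0 n w = (\sum_(0 <= k <oo) (a n k * xi k w ^+ 2)%:E)%E.
    by apply: eq_eseriesr => k _; rewrite addn0.
  by apply/seteqP; split => w wE i; have [N HN] := wE i; exists N => n /HN;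
    rewrite D0.
split; last first.
  rewrite ET; apply: (tail_event_zero_one xi_indep) => K.
  by rewrite (tail_eq c K); exact: tail_sigma_algebra.
rewrite ET; move: (@tail_sigma_algebra c 0%N); apply: smallest_sub.
  exact: sigma_algebra_measurable.
by move=> C; exact: measurable_cylinder.
Qed.

End weighted_squares.

(** * Second moments over rare events *)

Lemma measurable_superlevel {R : realType} {d : measure_display}
    {Omega : measurableType d} (f : Omega -> R) (t : R) :
  measurable_fun setT f -> measurable [set w | t <= f w].
Proof.
move=> mf; have -> : [set w | t <= f w] = setT `&` f @^-1` `[t, +oo[.
  by rewrite setTI; apply/seteqP; split => w /=; rewrite in_itv /= andbT.
by apply: mf => //; exact: measurable_itv.
Qed.

Section restricted_second_moment.
Context {R : realType} {d : measure_display} {Omega : measurableType d}.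
Variable P : probability Omega R.

(** The sum of the geometric series of ratio exp (- 1/4), which arises from the
    tails at the heights s, s + 1, s + 2 and so on. *)
Definition gauss_tail_sum : R := (1 - expR (- 4^-1))^-1.

Lemma gauss_tail_sum_ge0 : 0 <= gauss_tail_sum.
Proof. by rewrite invr_ge0 subr_ge0 -[leRHS]expR0 ler_expR oppr_le0 invr_ge0. Qed.

Lemma nneseries_gauss_tail (c s : R) : 0 <= c ->
  (\sum_(0 <= i <oo) (c * expR (- ((s + i%:R) / 4)))%:E =
   (c * gauss_tail_sum * expR (- (s / 4)))%:E)%E.
Proof.
move=> c0.
have e1 : `|expR (- 4^-1) : R| < 1.
  by rewrite ger0_norm ?expR_ge0 // -[ltRHS]expR0 ltr_expR oppr_lt0 invr_gt0.
apply/cvg_lim => //.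
have -> : (fun n => \sum_(0 <= i < n) (c * expR (- ((s + i%:R) / 4)))%:E)%E =
  EFin \o series (geometric (c * expR (- (s / 4))) (expR (- 4^-1))).
  apply/funext => n /=; rewrite sumEFin; congr EFin.
  apply: eq_bigr => i _ /=.
  rewrite mulrDl opprD expRD mulrA; congr (_ * _).
  by rewrite -expRM_natl mulrN.
apply/fine_cvgP; split; first exact: nearW.
have := cvg_geometric_series (a := c * expR (- (s / 4))) e1.
by rewrite mulrAC.
Qed.

(** The part of the square below s contributes at most s P(E); the part above s
    is cut into slices of height one, each controlled by the tail of b. With s
    of the order of - log P(E), both contributions are P(E) up to a factor linear
    in s, whereas the Cauchy-Schwarz inequality would give only the square root
    of P(E). *)
Lemma restricted_second_moment (b : Omega -> R) (E : set Omega) (c s : R) :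
  measurable_fun setT b -> (forall w, 0 <= b w) -> measurable E ->
  0 <= c -> 0 <= s ->
  (forall t, 0 <= t ->
     (P [set w | (t <= b w)%R] <= (c * expR (- (t ^+ 2 / 4)))%:E)%E) ->
  (\int[P]_(w in E) (b w ^+ 2)%:E <=
     s%:E * P E + (c * gauss_tail_sum * expR (- (s / 4)))%:E)%E.
Proof.
move=> mb b0 mE c0 s0 tail.
pose A i := [set w | Num.sqrt (s + i%:R) <= b w].
have mA i : measurable (A i) by exact: measurable_superlevel.
have m1 i : measurable_fun E (fun w => (\1_(A i) w : R)%:E).
  by apply/measurable_EFinP; apply: measurable_funTS; exact: measurable_indic.
have bound w : ((b w ^+ 2)%:E <= s%:E + \sum_(0 <= i <oo) (\1_(A i) w : R)%:E)%E.
  have [bs|sb] := leP (b w ^+ 2) s.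
    apply: (@le_trans _ _ s%:E); first by rewrite lee_fin.
    rewrite leeDl //; apply: nneseries_ge0 => i _ _.
    by rewrite lee_fin.
  (* A number y >= 0 is at most the number of naturals not exceeding it. *)
  have y0 : 0 <= b w ^+ 2 - s by rewrite subr_ge0 ltW.
  set y := b w ^+ 2 - s in y0.
  apply: (@le_trans _ _ (s%:E + \sum_(0 <= i < (Num.truncn y).+1)
      (\1_(A i) w : R)%:E)%E); last first.
    apply: leeD => //; apply: nneseries_lim_ge => i _ _.
    by rewrite lee_fin.
  rewrite sumEFin -EFinD lee_fin -lerBlDl.
  rewrite big_nat_cond (eq_bigr (fun=> 1)); last first.
    move=> i /andP[/andP[_ iy] _]; rewrite indicE mem_set //= /A /=.
    rewrite -(ger0_norm (b0 w)) -sqrtr_sqr ler_sqrt ?sqr_ge0 // addrC -lerBrDr.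
    by rewrite -/y -truncn_ge_nat.
  rewrite -big_nat_cond sumr_const_nat subn0.
  by apply: ltW; exact: truncnS_gt.
apply: (@le_trans _ _ (\int[P]_(w in E)
    (s%:E + \sum_(0 <= i <oo) (\1_(A i) w : R)%:E))%E).
  apply: ge0_le_integral => //.
  - by move=> w _; rewrite lee_fin sqr_ge0.
  - apply/measurable_EFinP; apply: measurable_funTS; exact: measurable_funX.
  - apply: emeasurable_funD; first exact: measurable_cst.
    by apply: ge0_emeasurable_sum => [i w _ _|i _]; rewrite ?lee_fin.
rewrite ge0_integralD //; last 2 first.
- by move=> w _; apply: nneseries_ge0 => i _ _; rewrite lee_fin.
- by apply: ge0_emeasurable_sum => [i w _ _|i _]; rewrite ?lee_fin.
rewrite integral_cst // integral_nneseries //.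
apply: leeD => //.
rewrite -nneseries_gauss_tail //.
apply: lee_nneseries => [i _ _|i _].
  by apply: integral_ge0 => w _; rewrite lee_fin.
rewrite integral_indic //.
apply: (le_trans (le_measure _ _ _ (@subIsetl _ (A i) E))); rewrite ?inE //.
  exact: measurableI.
apply: le_trans (tail _ (sqrtr_ge0 _)) _.
by rewrite sqr_sqrtr // addr_ge0.
Qed.

(** The Cauchy-Schwarz inequality, with one factor v ^ (1/2) in each vector. *)
Lemma sqr_weighted_sum (v b : nat -> R) n : (forall l, 0 <= v l) ->
  (\sum_(l < n) v l * b l) ^+ 2 <=
  (\sum_(l < n) v l) * \sum_(l < n) v l * b l ^+ 2.
Proof.
move=> v0; elim: n => [|n IH]; first by rewrite !big_ord0 expr0n mul0r.
rewrite !big_ord_recr /=.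
have V0 : 0 <= \sum_(l < n) v l by exact: sumr_ge0.
have Q0 : 0 <= \sum_(l < n) v l * b l ^+ 2.
  by apply: sumr_ge0 => l _; rewrite mulr_ge0 ?sqr_ge0.
move: (v0 n) IH V0 Q0; move: (v n) (b n) (\sum_(l < n) v l) => vn bn V.
move: (\sum_(l < n) v l * b l ^+ 2) (\sum_(l < n) v l * b l) => Q S vn0 IH V0 Q0.
suff SV : 2 * S * bn <= V * bn ^+ 2 + Q by nra.
have [V1|V1] := ltP 0 V; last first.
  have VE : V = 0 by apply/eqP; rewrite eq_le V1.
  have SE : S = 0.
    apply/eqP; rewrite -sqrf_eq0 eq_le sqr_ge0 andbT.
    by rewrite (le_trans IH) // VE mul0r.
  by rewrite VE SE !(mulr0, mul0r) add0r.
rewrite -(ler_pM2l V1).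
have := sqr_ge0 (V * bn - S); nra.
Qed.

Lemma sum_geometric_le (w : R) n : 1 < w ->
  \sum_(l < n) w ^+ l.+2 <= w / (w - 1) * w ^+ n.+1.
Proof.
move=> w1; have w10 : 0 < w - 1 by rewrite subr_gt0.
rewrite mulrAC ler_pdivlMr //.
suff -> : (\sum_(l < n) w ^+ l.+2) * (w - 1) = w ^+ n.+2 - w ^+ 2.
  by rewrite -exprS lerBlDr lerDl sqr_ge0.
elim: n => [|n IH]; first by rewrite big_ord0 mul0r subrr.
by rewrite big_ord_recr /= mulrDl IH !exprS expr0; move: (w ^+ n) => t; ring.
Qed.

Lemma sum_arith_geometric_le (th : R) n : 0 <= th < 1 ->
  \sum_(j < n) j.+1%:R * th ^+ j <= (1 - th) ^- 2.
Proof.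
move=> /andP[th0 th1]; have th10 : 0 < 1 - th by rewrite subr_gt0.
rewrite -[leRHS]mul1r ler_pdivlMr ?exprn_gt0 //.
suff -> : (\sum_(j < n) j.+1%:R * th ^+ j) * (1 - th) ^+ 2 =
    1 - th ^+ n * (1 + n%:R * (1 - th)).
  by rewrite lerBlDr lerDl mulr_ge0 ?exprn_ge0 // addr_ge0 // mulr_ge0 // ltW.
elim: n => [|n IH]; first by rewrite big_ord0 !mul0r expr0; ring.
by rewrite big_ord_recr /= mulrDl IH (exprS th) -natr1; move: (th ^+ n) (n%:R) => t s; ring.
Qed.

End restricted_second_moment.

Section tail_levels.
Context {R : realType} {d : measure_display} {Omega : measurableType d}.
Variable P : probability Omega R.

(** The second moments grow like w2 ^ (2 j) over events whose probabilities decay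
    like p ^ j. The truncation height (j + 1) tau ^ 2 makes the Gaussian tail at
    level j no larger than the bound p ^ (j + 1) on the probability of E j, which
    leaves the series of (j + 1) (w2 ^ 2 p) ^ (j + 1). *)
Lemma tail_levels_second_moment (b : nat -> Omega -> R) (E : nat -> set Omega)
    (w2 c tau p th : R) :
  (forall l, measurable_fun setT (b l)) -> (forall l w, 0 <= b l w) ->
  (forall j, measurable (E j)) -> 1 < w2 -> 0 <= c ->
  (forall l t, 0 <= t ->
     (P [set w | (t <= b l w)%R] <= (c * expR (- (t ^+ 2 / 4)))%:E)%E) ->
  expR (- (tau ^+ 2 / 4)) <= p ->
  (forall j, (P (E j) <= (p ^+ j.+1)%:E)%E) ->
  w2 ^+ 2 * p <= th -> th < 1 ->
  (\sum_(0 <= j <oo) \int[P]_(w in E j)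
      (w2 / (w2 - 1) * w2 ^+ j.+1 *
       \sum_(l < j) w2 ^+ l.+2 * b l w ^+ 2)%:E <=
   ((w2 / (w2 - 1)) ^+ 2 * (tau ^+ 2 + c * gauss_tail_sum) * (1 - th) ^- 2)%:E)%E.
Proof.
move=> mb b0 mE w21 c0 tail taup pE pth th1; set K := w2 / (w2 - 1).
have w20 : 0 < w2 by exact: lt_trans ltr01 w21.
have K0 : 0 <= K by rewrite divr_ge0 ?subr_ge0 ?(ltW w20) ?(ltW w21).
have p0 : 0 <= p by exact: le_trans (expR_ge0 _) taup.
have th0 : 0 <= th by apply: le_trans pth; rewrite mulr_ge0 ?sqr_ge0.
set M := tau ^+ 2 + c * gauss_tail_sum.
have M0 : 0 <= M by rewrite addr_ge0 ?sqr_ge0 // mulr_ge0 // gauss_tail_sum_ge0.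
have moment j l : (\int[P]_(w in E j) (b l w ^+ 2)%:E <=
    (j.+1%:R * M * p ^+ j.+1)%:E)%E.
  have s0 : 0 <= j.+1%:R * tau ^+ 2 :> R by rewrite mulr_ge0 ?sqr_ge0.
  apply: le_trans (restricted_second_moment (mb l) (b0 l) (mE j) c0 s0 (tail l)) _.
  apply: (@le_trans _ _ ((j.+1%:R * tau ^+ 2)%:E * (p ^+ j.+1)%:E +
     (c * gauss_tail_sum * expR (- (j.+1%:R * tau ^+ 2 / 4)))%:E)%E).
    by apply: leeD => //; apply: lee_wpmul2l; rewrite ?lee_fin.
  rewrite -EFinM -EFinD lee_fin /M mulrDr mulrDl lerD2l.
  have cg : 0 <= c * gauss_tail_sum by rewrite mulr_ge0 // gauss_tail_sum_ge0.
  apply: (@le_trans _ _ (c * gauss_tail_sum * p ^+ j.+1)).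
    apply: ler_wpM2l => //.
    rewrite -mulrA -mulrN expRM_natl.
    by apply: lerXn2r; rewrite ?nnegrE ?expR_ge0.
  apply: ler_wpM2r; first exact: exprn_ge0.
  by rewrite ler_peMl // ler1n.
have level j : (\int[P]_(w in E j)
      (K * w2 ^+ j.+1 * \sum_(l < j) w2 ^+ l.+2 * b l w ^+ 2)%:E <=
   (K ^+ 2 * M * (j.+1%:R * th ^+ j))%:E)%E.
  under eq_integral => w _.
    rewrite EFinM -sumEFin.
    under eq_bigr do rewrite EFinM.
    over.
  have mb2 l : measurable_fun (E j) (fun w => (b l w ^+ 2)%:E).
    by apply/measurable_EFinP; apply: measurable_funTS; exact: measurable_funX.
  have wb0 l w : (0 <= (w2 ^+ l.+2)%:E * (b l w ^+ 2)%:E)%E.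
    by rewrite -EFinM lee_fin mulr_ge0 ?sqr_ge0 // exprn_ge0 // ltW.
  rewrite ge0_integralZl_EFin //; last 3 first.
  - by move=> w _; apply: sume_ge0.
  - by apply: emeasurable_sum => l; exact: measurable_funeM.
  - by rewrite mulr_ge0 // exprn_ge0 // ltW.
  rewrite ge0_integral_sum //; last by move=> l; exact: measurable_funeM.
  apply: (@le_trans _ _ ((K * w2 ^+ j.+1)%:E *
      (\sum_(l < j) w2 ^+ l.+2 * (j.+1%:R * M * p ^+ j.+1))%:E)%E).
    apply: lee_wpmul2l; first by rewrite lee_fin mulr_ge0 // exprn_ge0 // ltW.
    rewrite -sumEFin; apply: lee_sum => l _.
    rewrite ge0_integralZl_EFin //; last 2 first.
    - by move=> w _; rewrite lee_fin sqr_ge0.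
    - by rewrite exprn_ge0 // ltW.
    rewrite [leRHS]EFinM; apply: lee_wpmul2l => //.
    by rewrite lee_fin exprn_ge0 // ltW.
  rewrite -EFinM lee_fin -mulr_suml.
  have jM0 : 0 <= j.+1%:R * M by rewrite mulr_ge0.
  apply: (@le_trans _ _ (K * w2 ^+ j.+1 *
      (K * w2 ^+ j.+1 * (j.+1%:R * M * p ^+ j.+1)))).
    apply: ler_wpM2l; first by rewrite mulr_ge0 // exprn_ge0 // ltW.
    apply: ler_wpM2r; first by rewrite mulr_ge0 // exprn_ge0.
    exact: sum_geometric_le.
  have -> : K * w2 ^+ j.+1 * (K * w2 ^+ j.+1 * (j.+1%:R * M * p ^+ j.+1)) =
      K ^+ 2 * M * (j.+1%:R * (w2 ^+ 2 * p) ^+ j.+1).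
    rewrite [(w2 ^+ 2 * p) ^+ _]exprMn [w2 ^+ 2 ^+ _]exprAC; move: (w2 ^+ j.+1) (p ^+ j.+1) (j.+1%:R) => x y z; ring.
  apply: ler_wpM2l; first by rewrite mulr_ge0 // sqr_ge0.
  apply: ler_wpM2l => //.
  apply: (@le_trans _ _ (th ^+ j.+1)).
    by apply: lerXn2r; rewrite ?nnegrE // mulr_ge0 ?sqr_ge0.
  by rewrite exprS ler_piMl ?exprn_ge0 // ltW.
apply: (@le_trans _ _
  (\sum_(0 <= j <oo) (K ^+ 2 * M * (j.+1%:R * th ^+ j))%:E)%E).
  apply: lee_nneseries => [j _ _|j _]; last exact: level.
  apply: integral_ge0 => w _.
  rewrite lee_fin mulr_ge0 //; first by rewrite mulr_ge0 // exprn_ge0 // ltW.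
  apply: sumr_ge0 => l _.
  by rewrite mulr_ge0 ?sqr_ge0 // exprn_ge0 // ltW.
apply: lime_le.
  apply: is_cvg_nneseries => j _ _.
  rewrite lee_fin; apply: mulr_ge0; first by rewrite mulr_ge0 ?sqr_ge0.
  by rewrite mulr_ge0 ?exprn_ge0.
apply: nearW => n; rewrite sumEFin lee_fin big_mkord -mulr_sumr.
apply: ler_wpM2l; first by rewrite mulr_ge0 // sqr_ge0.
by apply: sum_arith_geometric_le; rewrite th0.
Qed.

End tail_levels.

(** * Almost surely some level is accepted *)

Section acceptance.
Context {R : realType} {d : measure_display} {Omega : measurableType d}.
Variable P : probability Omega R.
Variable xi : nat -> {RV P >-> R}.
Hypothesis xi_indep : independent_seq xi.
Variables (a : nat -> nat -> R) (b z : nat -> Omega -> R) (err : nat -> R).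
Variables (G : set Omega) (c tau : R) (N0 : nat).
Hypothesis a_ge0 : forall n k, 0 <= a n k.
Hypothesis a_cvg0 : forall k, a n k @[n --> \oo] --> 0.
Hypothesis err_cvg0 : err n @[n --> \oo] --> 0.
Hypothesis mb : forall n, measurable_fun setT (b n).
Hypothesis b_ge0 : forall n w, 0 <= b n w.
Hypothesis mG : measurable G.
Hypothesis PG : P G = 1%E.
Hypothesis z_ge0 : forall n w, 0 <= z n w.
Hypothesis zE : forall n w, (0 < n)%N -> G w ->
  ((z n w ^+ 2)%:E = \sum_(0 <= k <oo) (a n k * xi k w ^+ 2)%:E)%E.
Hypothesis bz : forall n w, (0 < n)%N -> G w -> `|4 * b n w - z n w| <= err n.
Hypothesis tail : forall t n, 0 <= t -> (N0 < n)%N ->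
  (P [set w | (t <= b n w)%R] <= (c * expR (- (t ^+ 2 / 4)))%:E)%E.
Hypothesis tau_gt0 : 0 < tau.
Hypothesis ctau : c * expR (- (tau ^+ 2 / 4)) < 1.

Let Fset t N := \bigcap_(n in [set n | (N <= n)%N]) [set w | t <= b n w].

Let mge t n : measurable [set w | t <= b n w].
Proof. exact: measurable_superlevel. Qed.

Let mF t N : measurable (Fset t N).
Proof. by apply: bigcap_measurableType => n _; exact: mge. Qed.

Let eventually_ge_prob t : 0 <= t ->
  (P (\bigcup_N Fset t N) <= (c * expR (- (t ^+ 2 / 4)))%:E)%E.
Proof.
move=> t0.
have cv : P (Fset t N) @[N --> \oo] --> P (\bigcup_N Fset t N).
  apply: nondecreasing_cvg_mu => //; first exact: bigcupT_measurable.
  move=> m n mn; apply/subsetPset => w wF k /= nk.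
  by apply: wF => /=; exact: leq_trans nk.
rewrite -(cvg_lim _ cv) //; apply: lime_le; first by apply/cvg_ex; eexists; exact: cv.
apply: nearW => N.
apply: le_trans (tail t0 (leq_maxr N N0.+1)).
apply: le_measure; rewrite ?inE //.
by move=> w; apply; rewrite /= leq_maxl.
Qed.

Let c_ge1 : 1 <= c.
Proof.
have := tail (lexx 0) (ltnSn N0).
rewrite (_ : [set w | _] = setT); last first.
  by apply/seteqP; split => w //= _; exact: b_ge0.
by rewrite probability_setT expr0n mul0r oppr0 expR0 mulr1 lee_fin.
Qed.

(** If all levels were rejected with positive probability, the corresponding
    tail event would have probability one; then the functional would eventually
    exceed every threshold below tau almost surely, against its Gaussian
    tail. *)
Lemma all_rejected_null :
  P [set w | forall n, (0 < n)%N -> tau <= b n w] = 0%E.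
Proof.
set E0 := [set w | _].
have mE0 : measurable E0.
  have -> : E0 = \bigcap_(n in [set n | (0 < n)%N]) [set w | tau <= b n w] by [].
  exact: bigcap_measurableType.
have [mT zo] := liminf_weighted_squares_zero_one xi_indep a_ge0 a_cvg0
  ((4 * tau) ^+ 2).
move: mT zo; set T := [set w | _] => mT zo.
have PGI A : measurable A -> P (A `&` G) = P A.
  move=> mA; have PGC : P (~` G) = 0%E by rewrite probability_setC // PG subee.
  rewrite -(measureU0 _ (measurableC mG) PGC); last exact: measurableI.
  by rewrite setUIl setUv setIT measureU0 //; exact: measurableC.
have E0T : E0 `&` G `<=` T.
  move=> w [wE wG] i.
  have e0 : 0 < (8 * tau * i.+1%:R)^-1 by rewrite invr_gt0 !mulr_gt0.
  move/cvgr0Pnorm_le: err_cvg0 => /(_ _ e0) [N _ HN].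
  exists (maxn N 1) => n; rewrite geq_max => /andP[Nn n1].
  rewrite -zE // lee_fin.
  have := le_trans (ler_norm _) (HN _ Nn) => /= errn.
  have := bz n1 wG; rewrite ler_norml => /andP[_ bzn].
  have := wE _ n1 => taub.
  have : 8 * tau * err n <= i.+1%:R^-1.
    have : 8 * tau * err n <= 8 * tau * (8 * tau * i.+1%:R)^-1.
      by rewrite ler_pM2l // mulr_gt0.
    by rewrite [(8 * tau * _)^-1]invfM mulrA divff ?mul1r // gt_eqF // mulr_gt0.
  have z0 := z_ge0 n w.
  move: (i.+1%:R^-1) => s.
  have zerr : 4 * tau - err n <= z n w by lra.
  have [le0|gt0] := leP (4 * tau) (err n).
    have : 0 <= (z n w) ^+ 2 by exact: sqr_ge0.
    have : 8 * tau * (4 * tau) <= 8 * tau * err n by rewrite ler_pM2l // mulr_gt0.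
    by have := sqr_ge0 tau; rewrite exprMn; lra.
  have : (4 * tau - err n) ^+ 2 <= z n w ^+ 2.
    by apply: lerXn2r => //; rewrite nnegrE // subr_ge0 ltW.
  by have := sqr_ge0 (err n); nra.
apply/eqP; rewrite eq_le measure_ge0 andbT -(PGI _ mE0).
apply: (@le_trans _ _ (P T)).
  by apply: le_measure; rewrite ?inE //; exact: measurableI.
case: zo => [->//|PT]; exfalso.
have lnc : 0 <= ln c by rewrite ln_ge0.
(* The threshold t, with square t2, lies strictly between 2 * sqrt (ln c), where
   the Gaussian bound equals 1, and tau. *)
pose t2 := (4 * ln c + tau ^+ 2) / 2.
have lnct : 4 * ln c < tau ^+ 2.
  have c0 : 0 < c by exact: lt_le_trans ltr01 c_ge1.
  move: ctau; rewrite -{1}(lnK c0) -expRD -[ltRHS]expR0 ltr_expR; lra.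
have t20 : 0 <= t2 by rewrite divr_ge0 // addr_ge0 ?sqr_ge0 // mulr_ge0.
pose t := Num.sqrt t2.
have t0 : 0 <= t by exact: sqrtr_ge0.
have tsq : t ^+ 2 = t2 by rewrite sqr_sqrtr.
have ttau : t < tau.
  by rewrite -(ltr_pXn2r (n := 2)) ?nnegrE ?(ltW tau_gt0) // tsq /t2; lra.
have TF : T `&` G `<=` \bigcup_N Fset t N.
  move=> w [wT wG].
  (* The gap between t and tau pays both for the lower limit and for err. *)
  pose m := (t + tau) / 2.
  have mtau : 0 < (4 * tau) ^+ 2 - (4 * m) ^+ 2.
    rewrite subr_gt0 ltr_pXn2r ?nnegrE /m //; lra.
  have [i im] : exists i, i.+1%:R^-1 <= (4 * tau) ^+ 2 - (4 * m) ^+ 2.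
    exists (Num.truncn ((4 * tau) ^+ 2 - (4 * m) ^+ 2)^-1).
    rewrite -[leRHS]invrK lef_pV2 ?posrE ?invr_gt0 //.
    by apply: ltW; exact: truncnS_gt.
  have [N HN] := wT i.
  have e0 : 0 < 4 * (m - t) by rewrite /m; lra.
  move/cvgr0Pnorm_le: err_cvg0 => /(_ _ e0) [M _ HM].
  exists (maxn (maxn N M) 1) => // n /=; rewrite !geq_max => /andP[/andP[Nn Mn] n1].
  have := le_trans (ler_norm _) (HM _ Mn) => /= errn.
  have := bz n1 wG; rewrite ler_norml => /andP[bzn _].
  have := HN _ Nn; rewrite -zE // lee_fin => zn.
  have mz : 4 * m <= z n w.
    have m0 : 0 <= 4 * m by rewrite /m; lra.
    rewrite -(ler_pXn2r (n := 2)) ?nnegrE ?m0 ?z_ge0 //.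
    by move: zn im; move: (i.+1%:R^-1) => s; lra.
  by move: mz errn bzn; rewrite /m; lra.
have : (1 <= (c * expR (- (t ^+ 2 / 4)))%:E)%E.
  apply: le_trans (eventually_ge_prob t0).
  rewrite -PT -(PGI _ mT).
  by apply: le_measure; rewrite ?inE //; [exact: measurableI|exact: bigcupT_measurable].
rewrite lee_fin leNgt => /negP; apply.
have c0 : 0 < c by exact: lt_le_trans ltr01 c_ge1.
rewrite tsq -{1}(lnK c0) -expRD -[ltRHS]expR0 ltr_expR /t2; lra.
Qed.

End acceptance.

(** * The propagated noise *)

Section propagated_noise.
Context {R : realType} {X : completeNormedModType R}.
Variables (ip : {dot X for idfun}) (u : nat -> X).
Hypothesis ipE : induces_norm ip.
Hypothesis uB : orthonormal_basis ip u.
Context {d : measure_display} {Omega : measurableType d}.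
Variable P : probability Omega R.
Variables (sigma : nat -> R) (xi : nat -> {RV P >-> R}) (alpha : nat -> R).
Hypothesis sigma_gt0 : forall k, 0 < sigma k.
Hypothesis alpha_gt0 : forall n, 0 < alpha n.
Hypothesis alpha_noninc : nonincreasing_seq alpha.
Hypothesis alpha_cvg0 : alpha n @[n --> \oo] --> 0.

Let gain n k := sigma k / (sigma k ^+ 2 + alpha n).
Let eta n w := propagated_noise sigma u xi (alpha n) w.
Let converges n w := cvgn (noise_series sigma u xi (alpha n) w).

Let denom_gt0 n k : 0 < sigma k ^+ 2 + alpha n.
Proof. by rewrite addr_gt0 // exprn_gt0. Qed.

Let gain_gt0 n k : 0 < gain n k. Proof. by rewrite divr_gt0. Qed.

Let gain_le m n k : (m <= n)%N -> gain m k <= gain n k.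
Proof.
move=> mn; rewrite ler_pM2l // lef_pV2 ?posrE //.
by rewrite lerD2l alpha_noninc.
Qed.

Lemma gain_sub_cvg0 k : gain n.+1 k - gain n k @[n --> \oo] --> 0.
Proof.
have g : gain n k @[n --> \oo] --> sigma k / (sigma k ^+ 2 + 0).
  apply: cvgM; first exact: cvg_cst.
  apply: cvgV; first by rewrite addr0 expf_neq0 // gt_eqF.
  by apply: cvgD => //; exact: cvg_cst.
rewrite -(subrr (sigma k / (sigma k ^+ 2 + 0))); apply: cvgB => //.
by rewrite (cvg_shiftS (gain^~ k)).
Qed.

Lemma coord_measurable_noise n : coord_measurable ip u (eta n).
Proof.
apply: (coord_measurable_expansion ipE uB) => k.
by apply: measurable_funM => //; exact: measurable_cst.
Qed.

Lemma measurable_noise_converges n : measurable [set w | converges n w].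
Proof.
apply: (measurable_cvgn_expansion ipE uB) => k.
by apply: measurable_funM => //; exact: measurable_cst.
Qed.

Lemma noise_coord n w k : converges n w -> ip (eta n w) (u k) = gain n k * xi k w.
Proof. by move=> cw; exact: (coord_of_expansion ipE uB (c := fun k => gain n k * xi k w)). Qed.

(** Smaller regularization parameters damp every coordinate of the noise less,
    for each realization of the noise and not only in the mean. *)
Lemma norm_noise_le m n w : (m <= n)%N -> converges m w -> converges n w ->
  `|eta m w| <= `|eta n w|.
Proof.
move=> mn cm cn; rewrite -ler_sqr ?nnegrE // -lee_fin.
rewrite !(parseval_nneseries ipE uB).
apply: lee_nneseries => [k _ _|k _]; first by rewrite lee_fin sqr_ge0.
rewrite lee_fin !noise_coord // (exprMn _ (gain m k)) (exprMn _ (gain n k)).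
by rewrite ler_wpM2r ?sqr_ge0 // ler_sqr ?nnegrE ?gain_le // ltW.
Qed.

Lemma norm_noise_sub n w : converges n w -> converges n.+1 w ->
  ((`|eta n.+1 w - eta n w| ^+ 2)%:E =
   \sum_(0 <= k <oo) ((gain n.+1 k - gain n k) ^+ 2 * xi k w ^+ 2)%:E)%E.
Proof.
move=> cn cn1; rewrite (parseval_nneseries ipE uB).
apply: eq_eseriesr => k _; rewrite ipBl !noise_coord //.
by rewrite -mulrBl (exprMn _ (_ - _)).
Qed.

(** The normal law has no atom at 0, so the noise does not vanish almost surely. *)
Lemma noise_second_moment_gt0 delta n : white_noise delta xi ->
  {ae P, forall w, converges n w} ->
  (0 < \int[P]_w (`|eta n w| ^+ 2)%:E)%E.
Proof.
move=> [_ xi_normal] cvg_ae.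
rewrite lt_neqAle integral_ge0 ?andbT; last by move=> w _; rewrite lee_fin sqr_ge0.
apply/negP => /eqP/esym int0.
have mf : measurable_fun setT (fun w => (`|eta n w| ^+ 2)%:E).
  apply/measurable_EFinP; apply: measurable_funX.
  exact: (measurable_norm_coord ipE uB (@coord_measurable_noise n)).
have : ae_eq P setT (fun w => (`|eta n w| ^+ 2)%:E) (cst 0%E).
  apply/(ae_eq_integral_abs P measurableT mf).
  rewrite -[RHS]int0; apply: eq_integral => w _.
  by rewrite gee0_abs // lee_fin sqr_ge0.
move=> eta0.
have mB : measurable (xi 0%N @^-1` [set 0]).
  by apply: measurable_funPTI; exact: measurable_set1.
have B0 : P (xi 0%N @^-1` [set 0]) = 0%E.
  have := xi_normal 0%N [set 0] (measurable_set1 _).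
  rewrite /distribution /pushforward => ->.
  exact: integral_set1.
have xi0 : {ae P, forall w, xi 0%N w = 0}.
  apply: filterS2 cvg_ae eta0 => w cw /(_ I) [] /eqP.
  rewrite sqrf_eq0 normr_eq0 => /eqP etaw.
  have := noise_coord 0 cw; rewrite etaw.
  rewrite (_ : ip 0 (u 0%N) = 0); last by rewrite linear0l.
  by move/eqP; rewrite eq_sym mulf_eq0 gt_eqF //= => /eqP.
have : P (~` (xi 0%N @^-1` [set 0])) = 0%E.
  exact: measure_negligible (measurableC mB) xi0.
by rewrite probability_setC // B0 sube0 => /eqP; rewrite onee_eq0.
Qed.


Lemma measurable_balancing_functional (xn : nat -> X) (rho : nat -> R) n :
  measurable_fun setT
    (balancing_functional rho (fun m w => xn m + eta m w) n).
Proof.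
apply: measurable_funM => //; apply: measurable_funM => //.
apply: (measurable_norm_coord ipE uB); apply: coord_measurableB;
  apply: coord_measurableD;
  by [exact: coord_measurable_cst|exact: coord_measurable_noise].
Qed.

(** The bias decreases geometrically while the noise level is bounded away from
    zero, so asymptotically the functional sees only the increments of the
    noise, in which each coordinate of the noise has vanishing weight. *)
Lemma all_levels_rejected_null (x : X) (xn : nat -> X) (rho : nat -> R)
    (w1 c tau : R) (N0 : nat) :
  let b := balancing_functional rho (fun n w => xn n + eta n w) in
  independent_seq xi ->
  {ae P, forall w n, (0 < n)%N -> converges n w} ->
  0 < rho 1%N -> (forall n, (0 < n)%N -> rho 1%N <= rho n) ->
  0 < w1 < 1 ->
  (forall n, (0 < n)%N -> `|x - xn n.+1| <= w1 * `|x - xn n|) ->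
  (forall t n, 0 <= t -> (N0 < n)%N ->
    (P [set w | (t <= b n w)%R] <= (c * expR (- (t ^+ 2 / 4)))%:E)%E) ->
  0 < tau -> c * expR (- (tau ^+ 2 / 4)) < 1 ->
  P [set w | forall n, (0 < n)%N -> tau <= b n w] = 0%E.
Proof.
move=> b xi_indep conv_ae r1 r1n /andP[w10 w11] bias_decr tail tau0 ctau.
have r0 n : 0 < rho n.+1 by exact: lt_le_trans r1 (r1n n.+1 isT).
pose G := \bigcap_(n in [set n | (0 < n)%N]) [set w | converges n w].
have mG : measurable G.
  by apply: bigcap_measurableType => n _; exact: measurable_noise_converges.
have PG : P G = 1%E.
  have GC : P (~` G) = 0%E by exact: measure_negligible (measurableC mG) conv_ae.
  by rewrite -[G]setCK probability_setC ?GC ?sube0 //; exact: measurableC.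
pose err n := geometric (2 * `|x - xn 1%N| / (w1 * rho 1%N)) w1 n.
have bias n : (0 < n)%N -> 2 * `|x - xn n| / rho 1%N <= err n.
  case: n => // n _; elim: n => [|n IH].
    rewrite /err /= expr1 le_eqVlt; apply/orP; left; apply/eqP.
    by field; rewrite !gt_eqF.
  apply: (@le_trans _ _ (w1 * (2 * `|x - xn n.+1| / rho 1%N))).
    rewrite !mulrA ler_pM2r ?invr_gt0 // -mulrA mulrCA ler_pM2l //.
    exact: bias_decr.
  have -> : err n.+2 = w1 * err n.+1 by rewrite /err /= exprS mulrCA.
  by rewrite ler_pM2l.
apply: (@all_rejected_null _ _ _ P xi xi_indep
  (fun n k => (rho n.+1) ^- 2 * (gain n.+1 k - gain n k) ^+ 2)
  b (fun n w => `|eta n.+1 w - eta n w| / rho n.+1) err G c tau N0) => //.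
- by move=> n k; rewrite mulr_ge0 ?sqr_ge0 // invr_ge0 sqr_ge0.
- move=> k.
  have up : (rho 1%N) ^- 2 * (gain n.+1 k - gain n k) ^+ 2 @[n --> \oo] --> 0.
    rewrite -(mulr0 ((rho 1%N) ^- 2)) -[X in _ * X](mulr0 0).
    apply: cvgM; first exact: cvg_cst.
    by under eq_fun do rewrite expr2; apply: cvgM; exact: gain_sub_cvg0.
  apply: (squeeze_cvgr _ (cvg_cst 0) up); apply: nearW => n.
  rewrite mulr_ge0 ?sqr_ge0 ?invr_ge0 ?sqr_ge0 //=.
  rewrite ler_wpM2r ?sqr_ge0 // lef_pV2 ?posrE ?exprn_gt0 //.
  by rewrite lerXn2r ?nnegrE ?(ltW (r0 _)) ?(ltW r1) // r1n.
- by apply: cvg_geometric; rewrite gtr0_norm.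
- by move=> n; exact: measurable_balancing_functional.
- by move=> n w; rewrite /b /balancing_functional mulr_ge0 ?mulr_ge0 // invr_ge0 ltW.
- by move=> n w; rewrite divr_ge0 // ltW.
- move=> n w n0 wG; have cn := wG n n0; have cn1 := wG n.+1 isT.
  under eq_eseriesr do rewrite -mulrA EFinM.
  rewrite nneseriesZl -?norm_noise_sub //; last first.
    by move=> k _; rewrite lee_fin mulr_ge0 ?sqr_ge0.
  by rewrite -EFinM exprMn exprVn mulrC.
- move=> n w n0 _; rewrite /b /balancing_functional.
  apply: le_trans (bias n n0); rewrite !mulrA divff ?mul1r // -mulrBl.
  rewrite normrM (gtr0_norm (_ : 0 < _^-1)) ?invr_gt0 //.
  apply: ler_pM => //; first by rewrite invr_ge0 ltW.
    have cancel (p p' e e' : X) : p + e - (p' + e') - (e - e') = p - p'.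
      by rewrite (opprD p') opprB !addrA subrK addrAC addrK.
    rewrite (distrC (eta n.+1 w)); apply: le_trans (ler_dist_dist _ _) _.
    rewrite cancel.
    have := bias_decr n n0; have := ler_distD x (xn n) (xn n.+1).
    by rewrite (distrC _ x); have := normr_ge0 (x - xn n); nra.
  by rewrite lef_pV2 ?posrE // r1n.
Qed.

End propagated_noise.

(** * The balancing level *)

Section balancing_level.
Context {R : realType}.

(** The value 0 stands for the absence of an accepted level, which is why every
    positive index counts as rejected when n is 0. *)
Lemma balancing_levelP (b : nat -> R) (tau : R) (n : nat) :
  balancing_level b tau = n <->
  (forall m, (0 < m)%N -> (m < n)%N || (n == 0)%N -> tau <= b m) /\
  ((0 < n)%N -> b n < tau).
Proof.
rewrite /balancing_level; case: pselect => [h|h].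
  case: ex_minnP => m /andP[m0 bm] minm; split.
    move=> <-; split => // k k0 /orP[km|]; last by rewrite gtn_eqF.
    rewrite leNgt; apply/negP => bk.
    by have := minm k; rewrite k0 bk leqNgt km => /(_ isT).
  move=> [below]; case: n below => [|n] below bn.
    by have := below m m0; rewrite orbT => /(_ isT); rewrite leNgt bm.
  apply/eqP; rewrite eqn_leq minm ?bn //= leqNgt; apply/negP => mn.
  by have := below m m0; rewrite mn => /(_ isT); rewrite leNgt bm.
split=> [<-|[_]].
  split => // m m0 _; rewrite leNgt; apply/negP => bm.
  by apply: h; exists m; rewrite m0.
case: n => // n bn; exfalso; apply: h; exists n.+1; exact: bn.
Qed.

Context {d : measure_display} {Omega : measurableType d}.

Lemma measurable_balancing_level (b : nat -> Omega -> R) (tau : R) n :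
  (forall m, measurable_fun setT (b m)) ->
  measurable [set w | balancing_level (b^~ w) tau = n].
Proof.
move=> mb.
have mge m := measurable_superlevel tau (mb m).
have mlt m : measurable [set w | b m w < tau].
  rewrite (_ : [set _ | _] = ~` [set w | tau <= b m w]); first exact: measurableC.
  by apply/seteqP; split => w /=; rewrite ltNge => /negP.
have -> : [set w | balancing_level (b^~ w) tau = n] =
    (\bigcap_(m in [set m | (0 < m)%N /\ (m < n)%N || (n == 0)%N])
       [set w | tau <= b m w]) `&`
    (if (0 < n)%N then [set w | b n w < tau] else setT).
  apply/seteqP; split => w /=.
    move=> /balancing_levelP[below bn]; split => [m /= [m0 mn]|].
      exact: below.
    by case: ifP => // n0; exact: bn.
  move=> [below bn]; apply/balancing_levelP; split => [m m0 mn|n0].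
    exact: (below m (conj m0 mn)).
  by move: bn; rewrite n0.
apply: measurableI; last by case: ifP.
exact: bigcap_measurableType.
Qed.

Lemma measurable_at_level (b : nat -> Omega -> R) (tau : R)
    (g : nat -> Omega -> R) :
  (forall m, measurable_fun setT (b m)) ->
  (forall m, measurable_fun setT (g m)) ->
  measurable_fun setT (fun w => g (balancing_level (b^~ w) tau) w).
Proof.
move=> mb mg.
pose E n := [set w | balancing_level (b^~ w) tau = n].
have -> : setT = \bigcup_n E n.
  by apply/seteqP; split => w // _; exists (balancing_level (b^~ w) tau).
apply/measurable_fun_bigcup => n; first exact: measurable_balancing_level.
apply: (eq_measurable_fun (g n)); last exact: measurable_funTS.
by move=> w; rewrite inE /E /= => ->.
Qed.

End balancing_level.

Section pathwise_error.
Context {R : realType} {X : normedModType R}.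
Variables (x : X) (xn eta : nat -> X) (rho b : nat -> R) (w1 w2 tau : R) (N : nat).
Let xd n := xn n + eta n.
Hypothesis w1_lt1 : 0 < w1 < 1.
Hypothesis w2_gt1 : 1 < w2.
Hypothesis tau_ge0 : 0 <= tau.
Hypothesis N_gt0 : (0 < N)%N.
Hypothesis bias_decr : forall n, (0 < n)%N -> `|x - xn n.+1| <= w1 * `|x - xn n|.
Hypothesis rho_gt0 : forall n, (0 < n)%N -> 0 < rho n.
Hypothesis rho_incr : forall n, (0 < n)%N -> rho n <= rho n.+1 <= w2 * rho n.
Hypothesis bE : forall n, b n = 4^-1 * `|xd n - xd n.+1| * (rho n.+1)^-1.

Lemma step_norm n : `|xd n - xd n.+1| = 4 * rho n.+1 * b n.
Proof.
rewrite bE; have := rho_gt0 (ltn0Sn n); rewrite lt0r => /andP[r0 _].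
by field.
Qed.

Lemma rho_le m n : (0 < m)%N -> (m <= n)%N -> rho m <= rho n.
Proof.
move=> m0; elim: n => [|n IH]; first by rewrite leqn0 => /eqP ->.
rewrite leq_eqVlt => /predU1P[->//|mn]; apply: le_trans (IH mn) _.
by have /andP[] := rho_incr (leq_trans m0 mn).
Qed.

Lemma rho_geometric j : rho (N + j)%N <= w2 ^+ j * rho N.
Proof.
elim: j => [|j IH]; first by rewrite addn0 expr0 mul1r.
rewrite addnS exprS -mulrA.
have /andP[_ h] := rho_incr (ltn_addr j N_gt0).
by apply: le_trans h _; rewrite ler_pM2l // (lt_trans _ w2_gt1).
Qed.

(** At an accepted level the increment of the reconstruction is small, and the
    bias is at most a multiple of its own decrease: acceptance bounds the bias
    by the noise. *)
Lemma early_error n : (0 < n)%N -> (n <= N)%N -> b n < tau ->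
  (forall m, (0 < m)%N -> (m <= N)%N -> `|eta m| <= `|eta N|) ->
  `|xd n - x| ^+ 2 <= 3 * `|xn N - x| ^+ 2 +
    (48 * tau ^+ 2 * rho N ^+ 2 + 27 * `|eta N| ^+ 2) / (1 - w1) ^+ 2.
Proof.
move=> n0 nN btau noise; have /andP[w10 w11] := w1_lt1.
have v0 : 0 < 1 - w1 by rewrite subr_gt0.
have rN := rho_gt0 N_gt0.
have eN : 0 <= `|xn N - x| by [].
have hN : 0 <= `|eta N| by [].
have main : `|xd n - x| <=
    `|xn N - x| + (4 * tau * rho N + 3 * `|eta N|) / (1 - w1).
  have split_err : `|xd n - x| <= `|xn n - x| + `|eta n|.
    by rewrite /xd addrAC; exact: ler_normD.
  apply: le_trans split_err _.
  move: nN; rewrite leq_eqVlt => /predU1P[nN|nN].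
    rewrite nN lerD2l ler_pdivlMr //.
    have : `|eta N| * (1 - w1) <= `|eta N| by rewrite ler_piMr //; lra.
    have : 0 <= tau * rho N by rewrite mulr_ge0 // ltW.
    lra.
  have hn := noise n n0 (ltnW nN); have hn1 := noise n.+1 isT nN.
  have step : `|xd n - xd n.+1| <= 4 * tau * rho N.
    rewrite step_norm -!mulrA ler_pM2l // mulrC.
    apply: ler_pM; rewrite ?(ltW btau) ?rho_le // ?(ltW (rho_gt0 _)) //.
    by rewrite bE mulr_ge0 ?mulr_ge0 // invr_ge0 ltW // rho_gt0.
  have tri : `|x - xn n| <= `|x - xn n.+1| + (`|xd n - xd n.+1| + `|eta n| + `|eta n.+1|).
    have -> : x - xn n = (x - xn n.+1) + ((xd n.+1 - xd n) + eta n - eta n.+1).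
      rewrite /xd; move: (xn n) (xn n.+1) (eta n) (eta n.+1) => p1 p2 e1 e2.
      by rewrite opprD !addrA !subrK addrAC addrK.
    apply: le_trans (ler_normD _ _) _; rewrite lerD2l.
    apply: le_trans (ler_normB _ _) _; rewrite lerD2r.
    by apply: le_trans (ler_normD _ _) _; rewrite lerD2r distrC.
  have := bias_decr n0 => dec.
  have : `|xn n - x| * (1 - w1) <= 4 * tau * rho N + 2 * `|eta N|.
    by rewrite distrC; lra.
  rewrite -ler_pdivlMr // => bias.
  have : `|eta n| <= `|eta N| / (1 - w1).
    rewrite ler_pdivlMr //; apply: le_trans hn.
    by rewrite ler_piMr //; lra.
  move: bias; rewrite !mulrDl; lra.
set a := `|xn N - x| in eN main *.
set h := `|eta N| in hN main *.
apply: (@le_trans _ _ ((a + (4 * tau * rho N + 3 * h) / (1 - w1)) ^+ 2)).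
  rewrite ler_sqr ?nnegrE // addr_ge0 // divr_ge0 ?(ltW v0) //.
  by rewrite addr_ge0 ?mulr_ge0 // ltW.
have -> : (48 * tau ^+ 2 * rho N ^+ 2 + 27 * h ^+ 2) / (1 - w1) ^+ 2 =
    3 * (4 * tau * rho N / (1 - w1)) ^+ 2 + 3 * (3 * h / (1 - w1)) ^+ 2.
  by field; rewrite gt_eqF.
rewrite mulrDl.
move: (4 * tau * rho N / (1 - w1)) (3 * h / (1 - w1)) => s t.
have := sqr_ge0 (a - s); have := sqr_ge0 (a - t); have := sqr_ge0 (s - t); nra.
Qed.

(** Beyond the optimal level the error is compared with the one just after the
    optimal level along the increments, which the functional measures in units
    of the geometrically growing noise level. *)
Lemma late_error j :
  `|xd (N + j.+1) - x| ^+ 2 <=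
    4 * `|xn N - x| ^+ 2 + 4 * `|eta N.+1| ^+ 2 +
    32 * rho N ^+ 2 * (w2 / (w2 - 1) * w2 ^+ j.+1 *
       \sum_(l < j) w2 ^+ l.+2 * b (N + l.+1) ^+ 2).
Proof.
have /andP[w10 w11] := w1_lt1.
have w20 : 0 < w2 by exact: lt_trans ltr01 w2_gt1.
have rN := rho_gt0 N_gt0.
have b0 n : 0 <= b n.
  by rewrite bE mulr_ge0 ?mulr_ge0 // invr_ge0 ltW // rho_gt0.
have tele : `|xd (N + j.+1) - xd (N + 1)| <=
    4 * rho N * \sum_(l < j) w2 ^+ l.+2 * b (N + l.+1).
  elim: j => [|j IH]; first by rewrite subrr normr0 big_ord0 mulr0.
  rewrite big_ord_recr /= mulrDr.
  have -> : xd (N + j.+2) - xd (N + 1) =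
      (xd (N + j.+1) - xd (N + 1)) - (xd (N + j.+1) - xd (N + j.+1).+1).
    by rewrite addnS opprB [RHS]addrC addrA subrK.
  apply: le_trans (ler_normB _ _) _; apply: lerD => //.
  have := ler_wpM2r (b0 (N + j.+1)%N) (rho_geometric j.+2).
  by rewrite step_norm (addnS N j.+1); move: (w2 ^+ j.+2) => W; lra.
set S := \sum_(l < j) _ in tele.
have S0 : 0 <= S.
  by apply: sumr_ge0 => l _; rewrite mulr_ge0 ?exprn_ge0 // ltW.
set Q := \sum_(l < j) _.
have SQ : S ^+ 2 <= w2 / (w2 - 1) * w2 ^+ j.+1 * Q.
  have v0 l : 0 <= w2 ^+ l.+2 by rewrite exprn_ge0 // ltW.
  apply: le_trans (sqr_weighted_sum (fun l => b (N + l.+1)%N) j v0) _.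
  apply: ler_wpM2r; last exact: sum_geometric_le.
  by apply: sumr_ge0 => l _; rewrite mulr_ge0 ?sqr_ge0 // exprn_ge0 // ltW.
have bias : `|xn (N + 1) - x| <= `|xn N - x|.
  rewrite distrC [leRHS]distrC addn1; apply: le_trans (bias_decr N_gt0) _.
  by rewrite ler_piMl // ltW.
have tri : `|xd (N + j.+1) - x| <=
    4 * rho N * S + (`|xn N - x| + `|eta N.+1|).
  have -> : xd (N + j.+1) - x =
     (xd (N + j.+1) - xd (N + 1)) + ((xn (N + 1) - x) + eta N.+1).
    rewrite /xd addn1; move: (xn (N + j.+1) + eta (N + j.+1)) (eta N.+1) => A h.
    by rewrite [_ - x + h]addrAC addrA subrK.
  apply: le_trans (ler_normD _ _) _; apply: lerD => //.
  by apply: le_trans (ler_normD _ _) _; rewrite lerD2r.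
apply: (@le_trans _ _ ((4 * rho N * S + (`|xn N - x| + `|eta N.+1|)) ^+ 2)).
  by rewrite ler_sqr ?nnegrE // addr_ge0 ?addr_ge0 // !mulr_ge0 // ltW.
have : 32 * rho N ^+ 2 * S ^+ 2 <= 32 * rho N ^+ 2 * (w2 / (w2 - 1) * w2 ^+ j.+1 * Q).
  by rewrite ler_pM2l // mulr_gt0 ?exprn_gt0.
move: (w2 / (w2 - 1) * _ * _) => T.
have -> : 32 * rho N ^+ 2 * S ^+ 2 = 2 * (4 * rho N * S) ^+ 2 by ring.
move: (4 * rho N * S) `|xn N - x| `|eta N.+1| => s a h.
move: (32 * _ * T) => T'.
have := sqr_ge0 (s - (a + h)); have := sqr_ge0 (a - h); nra.
Qed.

End pathwise_error.

Section integral_over_levels.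
Context {R : realType} {d : measure_display} {Omega : measurableType d}.
Variable P : probability Omega R.

(** Outcomes in the event E j may be charged with the extra term g j, integrated
    over that event only; all outcomes are charged with H. *)
Lemma le_integral_levels (f H : Omega -> R) (E : nat -> set Omega)
    (g : nat -> Omega -> R) (k : R) :
  measurable_fun setT f -> measurable_fun setT H ->
  (forall j, measurable (E j)) -> (forall j, measurable_fun setT (g j)) ->
  (forall w, 0 <= f w) -> (forall w, 0 <= H w) -> (forall j w, 0 <= g j w) ->
  0 <= k ->
  {ae P, forall w, f w <= H w \/ exists2 j, E j w & f w <= H w + k * g j w} ->
  (\int[P]_w (f w)%:E <= \int[P]_w (H w)%:E +
     k%:E * \sum_(0 <= j <oo) \int[P]_(w in E j) (g j w)%:E)%E.
Proof.
move=> mf mH mE mg f0 H0 g0 k0 fH.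
pose h j : Omega -> \bar R := (fun w => (g j w)%:E) \_ (E j).
have h0 j w : (0 <= h j w)%E.
  by rewrite /h patchE; case: ifP => _ //; rewrite lee_fin.
have mh j : measurable_fun setT (h j).
  apply/(measurable_restrictT _ (mE j)).1.
  by apply/measurable_EFinP; exact: measurable_funTS.
have mS : measurable_fun setT (fun w => \sum_(0 <= j <oo) h j w)%E.
  by apply: ge0_emeasurable_sum.
have S0 w : (0 <= \sum_(0 <= j <oo) h j w)%E by exact: nneseries_ge0.
have -> : (\sum_(0 <= j <oo) \int[P]_(w in E j) (g j w)%:E =
    \int[P]_w \sum_(0 <= j <oo) h j w)%E.
  rewrite integral_nneseries //; apply: eq_eseriesr => j _.
  by rewrite [LHS]integral_mkcond.
rewrite -ge0_integralZl_EFin // -ge0_integralD //; last 4 first.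
- by move=> w _; rewrite lee_fin.
- exact/measurable_EFinP.
- by move=> w _; rewrite mule_ge0.
- exact: measurable_funeM.
apply: ae_ge0_le_integral => //.
- by move=> w _; rewrite lee_fin.
- exact/measurable_EFinP.
- by move=> w _; rewrite adde_ge0 ?lee_fin // mule_ge0.
- apply: emeasurable_funD; first exact/measurable_EFinP.
  exact: measurable_funeM.
apply: filterS fH => w + _ => -[fw|[j Ejw fw]].
  by apply: (@le_trans _ _ (H w)%:E); rewrite ?lee_fin // leeDl // mule_ge0.
apply: (@le_trans _ _ ((H w)%:E + k%:E * (g j w)%:E)%E).
  by rewrite -EFinM -EFinD lee_fin.
apply: leeD => //; apply: lee_wpmul2l; first by rewrite lee_fin.
rewrite (@nneseriesD1 _ _ j) //; apply: (@le_trans _ _ (h j w)).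
  by rewrite /h patchE mem_set.
by rewrite leeDl //; apply: nneseries_ge0.
Qed.

End integral_over_levels.

(** * The oracle inequality *)

(** The coefficients of 1 and tau ^ 2 in the bound of the expected error; k1 and
    k2 stand for c3 and C3. The terms with 1 - w1 come from the levels up to the
    optimal one, the last ones from the levels beyond, where k2^-1 bounds the
    ratio of the series over the levels. *)
Definition error_const (R : realType) (k1 k2 w1 w2 : R) : R :=
  7 + 27 / (1 - w1) ^+ 2 + 4 * w2 ^+ 2 +
  32 * (w2 / (w2 - 1)) ^+ 2 * (k1 * gauss_tail_sum) * (1 - k2^-1) ^- 2.

Definition error_slope (R : realType) (k2 w1 w2 : R) : R :=
  48 / (1 - w1) ^+ 2 + 32 * (w2 / (w2 - 1)) ^+ 2 * (1 - k2^-1) ^- 2.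

Theorem theorem5p7 (R : realType) (c3 C3 : R -> R -> R) :
  exists c5 c6 : R -> R -> R,
  forall (X Y : completeNormedModType R)
    (ipX : {dot X for idfun}) (ipY : {dot Y for idfun})
    (A : {linear X -> Y}) (sigma : nat -> R) (u : nat -> X) (v : nat -> Y)
    (d : measure_display) (Omega : measurableType d) (P : probability Omega R)
    (delta : R) (xi : nat -> {RV P >-> R})
    (q0 q : R) (x : X) (rho : nat -> R) (nopt : nat) (w1 w2 tau : R),
  let alpha n := q0 * q ^+ n in
  let xn n := tikhonov ipX ipY A (alpha n) (A x) in
  let Axi n := propagated_noise sigma u xi (alpha n) in
  let xdelta n w := xn n + Axi n w in
  let b1 := balancing_functional rho xdelta in
  let nstar w := balancing_level (b1^~ w) tau in
  induces_norm ipX -> induces_norm ipY ->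
  separable X -> separable Y ->
  infinite_dimensional X -> infinite_dimensional Y ->
  compact_operator A -> (forall z, A z = 0 -> z = 0) ->
  singular_value_decomposition ipX ipY A sigma u v ->
  0 < q0 -> 0 < q < 1 ->
  0 < delta -> white_noise delta xi ->
  (forall n, (0 < n)%N ->
    {ae P, forall w, cvgn (noise_series sigma u xi (alpha n) w)}) ->
  (forall n, (0 < n)%N ->
    0 <= rho n /\
    ((rho n ^+ 2)%:E = 'E_P[fun w => (`|Axi n w| ^+ 2)%R])%E) ->
  spectral_assumption ipX ipY A sigma u x ->
  is_optimal_level x xn rho nopt ->
  0 < w1 < 1 -> 1 < w2 ->
  (forall n, (0 < n)%N -> `|x - xn n.+1| <= w1 * `|x - xn n|) ->
  (forall n, (0 < n)%N -> rho n <= rho n.+1 <= w2 * rho n) ->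
  0 < c3 w1 w2 ->
  (forall t : R, 0 <= t -> forall n, (nopt < n)%N ->
    (P [set w | (t <= b1 n w)%R] <= (c3 w1 w2 * expR (- (t ^+ 2 / 4)))%:E)%E) ->
  0 <= tau ->
  c3 w1 w2 < C3 w1 w2 ->
  (forall n, (nopt < n)%N ->
    (P [set w | nstar w = n]
       <= ((C3 w1 w2 * expR (- (tau ^+ 2 / 4))) ^+ (n - nopt))%:E)%E) ->
  C3 w1 w2 * expR (- (tau ^+ 2 / 4)) * w2 < 1 ->
  (* the geometric series summed in the conclusion converges *)
  C3 w1 w2 * expR (- (tau ^+ 2 / 8)) * w2 < 1 ->
  ('E_P[fun w => (`|xdelta (nstar w) w - x| ^+ 2)%R]
     <= (c5 w1 w2
           * (1 + c6 w1 w2 * expR (tau ^+ 2 / 2)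
                + c5 w1 w2
                    * (1 / (1 - C3 w1 w2 * expR (- (tau ^+ 2 / 8)) * w2)))
           * (`|xn nopt - x| ^+ 2 + rho nopt ^+ 2))%:E)%E.
Proof.
(* As tau ^ 2 <= 2 exp (tau ^ 2 / 2), the exponential term of the bound absorbs
   both coefficients. *)
exists (fun _ _ => 1), (fun w1 w2 => error_const (c3 w1 w2) (C3 w1 w2) w1 w2 +
                                2 * error_slope (C3 w1 w2) w1 w2).
move=> X Y ipX ipY A sigma u v d Omega P delta xi q0 q x rho N w1 w2 tau.
move=> alpha xn eta xd b1 nstar ipE _ _ _ _ _ _ _ [uB _ sigma0 _ _] q00.
move=> /andP[q_gt0 q_lt1] delta0 noise cvg_ae rhoE _ [N0 _ _] w1b w21.
move=> bias_decr rho_incr; move: (c3 w1 w2) (C3 w1 w2) => k1 k2.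
move=> k10 tail tau0 k12 law _ ratio.
have [xi_indep _] := noise.
have /andP[w10 w11] := w1b.
have alpha0 n : 0 < alpha n by rewrite mulr_gt0 // exprn_gt0.
have alpha_ni : nonincreasing_seq alpha.
  move=> m n mn; rewrite ler_pM2l //.
  by rewrite ler_wiXn2l // ltW.
have alpha_cvg : alpha n @[n --> \oo] --> 0.
  by have := @cvg_geometric R q0 q; apply; rewrite gtr0_norm.
have conv_ae : {ae P, forall w n, (0 < n)%N ->
    cvgn (noise_series sigma u xi (alpha n) w)}.
  apply: ae_foralln => -[|n]; first exact: aeW.
  by apply: filterS (cvg_ae n.+1 isT) => w cw _.
have eta2 n : (0 < n)%N -> (\int[P]_w (`|eta n w| ^+ 2)%:E = (rho n ^+ 2)%:E)%E.
  by move=> n0; rewrite (rhoE n n0).2 unlock.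
have r1 : 0 < rho 1%N.
  rewrite lt0r (rhoE 1%N isT).1 andbT; apply/eqP => r10.
  have := noise_second_moment_gt0 ipE uB sigma0 alpha0 noise (cvg_ae 1%N isT).
  by rewrite eta2 // r10 expr0n ltxx.
have r1n n : (0 < n)%N -> rho 1%N <= rho n.
  exact: (rho_le rho_incr).
have r0 n : (0 < n)%N -> 0 < rho n by move=> n0; exact: lt_le_trans (r1n n n0).
have b0 n w : 0 <= b1 n w.
  by rewrite /b1 /balancing_functional mulr_ge0 ?mulr_ge0 // invr_ge0 ltW // r0.
have mb n : measurable_fun setT (b1 n).
  exact: (measurable_balancing_functional ipE uB).
(* At t = 0 the tail bound applies to the whole space. *)
have k11 : 1 <= k1.
  have := tail 0 (lexx 0) N.+1 (ltnSn N).
  rewrite (_ : [set w | _] = setT); last first.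
    by apply/seteqP; split => w //= _; exact: b0.
  by rewrite probability_setT expr0n mul0r oppr0 expR0 mulr1 lee_fin.
have k21 : 1 < k2 by exact: le_lt_trans k12.
have k20 : 0 < k2 by exact: lt_trans ltr01 k21.
have w20 : 0 < w2 by exact: lt_trans ltr01 w21.
pose a := expR (- (tau ^+ 2 / 8)).
have a0 : 0 < a by exact: expR_gt0.
have a2 : expR (- (tau ^+ 2 / 4)) = a ^+ 2.
  by rewrite /a -expRM_natl; congr expR; field.
rewrite -/a a2 in ratio tail law *.
have k2a : k2 * a < 1.
  apply: le_lt_trans ratio; rewrite ler_peMr ?(ltW w21) //.
  by rewrite mulr_ge0 // ltW.
have a1 : a < 1.
  by apply: le_lt_trans k2a; rewrite ler_peMl ?(ltW k21) ?(ltW a0).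
(* For tau = 0 the factor a would be 1, and k2 * a * w2 would exceed 1. *)
have tau_gt0 : 0 < tau.
  rewrite lt0r tau0 andbT; apply/eqP => tauE.
  by move: a1; rewrite /a tauE expr0n mul0r oppr0 expR0 ltxx.
have never : P [set w | forall n, (0 < n)%N -> tau <= b1 n w] = 0%E.
  apply: (all_levels_rejected_null ipE uB sigma0 alpha_cvg xi_indep
    conv_ae r1 r1n w1b bias_decr (N0 := N) (c := k1)) => //.
    by move=> t n t0 Nn; exact: tail.
  rewrite a2; apply: le_lt_trans k2a.
  rewrite expr2 mulrA ler_pM2r //; apply: le_trans (ltW k12).
  by rewrite ler_piMr // ltW.
pose E j := [set w | nstar w = (N + j.+1)%N].
have mE j : measurable (E j) by exact: measurable_balancing_level.
pose K := w2 / (w2 - 1).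
pose g j w := K * w2 ^+ j.+1 * \sum_(l < j) w2 ^+ l.+2 * b1 (N + l.+1)%N w ^+ 2.
pose eN := `|xn N - x|.
pose B := 7 * eN ^+ 2 + 48 * tau ^+ 2 * rho N ^+ 2 / (1 - w1) ^+ 2.
pose H w := B +
  27 / (1 - w1) ^+ 2 * `|eta N w| ^+ 2 + 4 * `|eta N.+1 w| ^+ 2.
have levels : (\sum_(0 <= j <oo) \int[P]_(w in E j) (g j w)%:E <=
   (K ^+ 2 * (tau ^+ 2 + k1 * gauss_tail_sum) * (1 - k2^-1) ^- 2)%:E)%E.
  apply: (tail_levels_second_moment (b := fun l w => b1 (N + l.+1)%N w)
    (p := k2 * a ^+ 2)) => //.
  - exact: ltW.
  - by move=> l t t0; apply: tail => //; rewrite addnS ltnS leq_addr.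
  - by rewrite a2 ler_peMl ?sqr_ge0 // ltW.
  - by move=> j; have := law (N + j.+1)%N; rewrite addKn; apply; rewrite addnS ltnS leq_addr.
  - rewrite -[leRHS]mul1r ler_pdivlMr //.
    have -> : w2 ^+ 2 * (k2 * a ^+ 2) * k2 = (k2 * a * w2) ^+ 2 by ring.
    by rewrite expr_le1 // ?(ltW ratio) // !mulr_ge0 // ltW.
  - by rewrite invf_lt1.
have D0 : 0 <= (1 - w1) ^- 2 by rewrite invr_ge0 sqr_ge0.
have D27 : 0 <= 27 / (1 - w1) ^+ 2 by rewrite mulr_ge0.
have B0 : 0 <= B.
  apply: addr_ge0; first by rewrite mulr_ge0 ?sqr_ge0.
  by rewrite mulr_ge0 // mulr_ge0 ?sqr_ge0 // mulr_ge0 ?sqr_ge0.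
have K0 : 0 <= K by rewrite divr_ge0 ?subr_ge0 ?(ltW w20) ?(ltW w21).
have meta n : measurable_fun setT (fun w => `|eta n w| ^+ 2).
  apply: measurable_funX; apply: (measurable_norm_coord ipE uB).
  exact: coord_measurable_noise.
have mH : measurable_fun setT H.
  by apply: measurable_funD; [apply: measurable_funD => //|];
    apply: measurable_funM.
have H0 w : 0 <= H w.
  by apply: addr_ge0; [apply: addr_ge0 => //|]; rewrite mulr_ge0 ?sqr_ge0.
have mg j : measurable_fun setT (g j).
  apply: measurable_funM => //; apply: measurable_sum => l.
  by apply: measurable_funM => //; exact: measurable_funX.
have g0 j w : 0 <= g j w.
  rewrite mulr_ge0 //; first by rewrite mulr_ge0 // exprn_ge0 // ltW.
  by apply: sumr_ge0 => l _; rewrite mulr_ge0 ?sqr_ge0 // exprn_ge0 // ltW.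
have intH : (\int[P]_w (H w)%:E <= (B + 27 / (1 - w1) ^+ 2 * rho N ^+ 2 + 4 * (w2 * rho N) ^+ 2)%:E)%E.
  have -> : (fun w => (H w)%:E) = (fun w => B%:E +
      (27 / (1 - w1) ^+ 2)%:E * (`|eta N w| ^+ 2)%:E +
      4%:E * (`|eta N.+1 w| ^+ 2)%:E)%E by [].
  have e0 n w : (0 <= (`|eta n w| ^+ 2)%:E)%E by rewrite lee_fin sqr_ge0.
  have me n : measurable_fun setT (fun w => (`|eta n w| ^+ 2)%:E).
    exact/measurable_EFinP.
  have mc n c : measurable_fun setT (fun w => c%:E * (`|eta n w| ^+ 2)%:E)%E.
    exact: measurable_funeM.
  rewrite ge0_integralD //; last 2 first.
  - by move=> w _; rewrite adde_ge0 ?mule_ge0 ?lee_fin.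
  - exact: emeasurable_funD.
  rewrite ge0_integralD //; last by move=> w _; rewrite mule_ge0 ?lee_fin.
  rewrite !ge0_integralZl_EFin // !eta2 // integral_cst //= probability_setT mule1.
  rewrite -!EFinM -!EFinD lee_fin lerD2l ler_pM2l //.
  have /andP[_ h] := rho_incr N N0.
  by rewrite lerXn2r ?nnegrE ?(ltW (r0 _ _)) // mulr_ge0 // ltW // r0.
rewrite unlock.
have mxd n : measurable_fun setT (fun w => `|xd n w - x| ^+ 2).
  apply: measurable_funX; apply: (measurable_norm_coord ipE uB).
  apply: coord_measurableB; last exact: coord_measurable_cst.
  by apply: coord_measurableD; [exact: coord_measurable_cst|
    exact: coord_measurable_noise].
have accepted : {ae P, forall w, nstar w <> 0%N}.
  exists [set w | nstar w = 0%N]; split.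
  - exact: measurable_balancing_level.
  - rewrite -[RHS]never; congr (P _); apply/seteqP; split => w /=.
      by move=> /balancing_levelP[h _] n n0; apply: h => //; rewrite orbT.
    by move=> h; apply/balancing_levelP; split => // n n0 _; exact: h.
  - by move=> w /= /contrapT.
apply: (@le_trans _ _ (\int[P]_w (H w)%:E +
    (32 * rho N ^+ 2)%:E * \sum_(0 <= j <oo) \int[P]_(w in E j) (g j w)%:E)%E).
  apply: le_integral_levels => //.
  - exact: (measurable_at_level tau mb mxd).
  - by rewrite mulr_ge0 ?sqr_ge0.
  apply: filterS2 conv_ae accepted => w cw nw.
  have [_ bn] := (balancing_levelP _ _ _).1 (erefl (nstar w)).
  have n0 : (0 < nstar w)%N by rewrite lt0n; exact/eqP.
  have [nN|Nn] := leqP (nstar w) N.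
    left.
    have := early_error (x := x) (xn := xn) (eta := eta^~ w) (b := b1^~ w)
      w1b tau0 N0 bias_decr r0 rho_incr (fun n => erefl) n0 nN (bn n0).
    move=> /(_ _)/le_trans; apply.
      move=> m m0 mN; apply: (norm_noise_le ipE uB sigma0 alpha0) => //; exact: cw.
    rewrite /H /B -/eN mulrDl -(mulrA (48 * tau ^+ 2)).
    have := sqr_ge0 eN; have := sqr_ge0 `|eta N.+1 w|.
    move: ((1 - w1) ^+ 2)^-1 => D; lra.
  right; exists (nstar w - N).-1.
    by rewrite /E /= prednK ?subn_gt0 // subnKC // ltnW.
  have nE : nstar w = (N + (nstar w - N).-1.+1)%N.
    by rewrite prednK ?subn_gt0 // subnKC // ltnW.
  rewrite [in X in X <= _]nE.
  have := late_error (x := x) (xn := xn) (eta := eta^~ w) (b := b1^~ w)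
      w1b w21 N0 bias_decr r0 rho_incr (fun n => erefl) (nstar w - N).-1.
  move=> /le_trans; apply; apply: lerD => //.
  rewrite /H /B -/eN.
  have : 0 <= 48 * tau ^+ 2 * rho N ^+ 2 / (1 - w1) ^+ 2.
    by rewrite mulr_ge0 // mulr_ge0 ?sqr_ge0 // mulr_ge0 ?sqr_ge0.
  have : 0 <= 27 / (1 - w1) ^+ 2 * `|eta N w| ^+ 2 by rewrite mulr_ge0 ?sqr_ge0.
  have := sqr_ge0 eN; lra.
apply: (le_trans (leeD intH (lee_wpmul2l _ levels))).
  by rewrite lee_fin mulr_ge0 ?sqr_ge0.
rewrite -EFinM -EFinD lee_fin !mul1r -/eN.
set e := expR (tau ^+ 2 / 2).
have te : tau ^+ 2 <= 2 * e by have := expR_ge1Dx (tau ^+ 2 / 2); rewrite -/e; lra.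
have e1 : 1 <= e.
  by rewrite /e -[leLHS]expR0 ler_expR divr_ge0 ?sqr_ge0.
have geom : 0 <= (1 - k2 * a * w2)^-1 by rewrite invr_ge0 subr_ge0 ltW.
have kg0 : 0 <= k1 * gauss_tail_sum by rewrite mulr_ge0 ?gauss_tail_sum_ge0 // ltW.
have T0 : 0 <= (1 - k2^-1) ^- 2 by rewrite invr_ge0 sqr_ge0.
have K20 : 0 <= K ^+ 2 by exact: sqr_ge0.
have S0 : 0 <= eN ^+ 2 + rho N ^+ 2 by rewrite addr_ge0 ?sqr_ge0.
have const7 : 7 <= error_const k1 k2 w1 w2.
  rewrite /error_const -/K; move: D27 (sqr_ge0 w2) => h1 h2.
  by have := mulr_ge0 (mulr_ge0 K20 kg0) T0; lra.
have slope0 : 0 <= error_slope k2 w1 w2.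
  rewrite /error_slope -/K; have := mulr_ge0 K20 T0; have := D0; lra.
apply: (@le_trans _ _ ((error_const k1 k2 w1 w2 +
    tau ^+ 2 * error_slope k2 w1 w2) * (eN ^+ 2 + rho N ^+ 2))).
  have : 0 <= (error_const k1 k2 w1 w2 - 7 + tau ^+ 2 * error_slope k2 w1 w2) *
      eN ^+ 2.
    by rewrite mulr_ge0 ?sqr_ge0 // addr_ge0 ?subr_ge0 // mulr_ge0 ?sqr_ge0.
  have := sqr_ge0 (rho N).
  rewrite /B /error_const /error_slope -/K exprMn.
  move: ((1 - w1) ^+ 2)^-1 ((1 - k2^-1) ^+ 2)^-1 (k1 * gauss_tail_sum) (K ^+ 2).
  by move=> D T kg K2; lra.
apply: ler_wpM2r => //.
have : tau ^+ 2 * error_slope k2 w1 w2 <= 2 * e * error_slope k2 w1 w2.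
  exact: ler_wpM2r.
have : error_const k1 k2 w1 w2 <= error_const k1 k2 w1 w2 * e.
  by rewrite ler_peMr // (le_trans _ const7).
lra.
Qed.
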